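(* Let $\mathbb K$ be a field of characteristic different from $2$, let $s\ge 0$ be an integer, let $(g_{\lambda\mu})$ be the matrix of a nondegenerate symmetric bilinear form on $\mathbb K^{s+1}$, with inverse matrix $(g^{\lambda\mu})$, and let $\tilde E=\bigoplus_{\lambda=0}^{s}\mathbb K S_\lambda$ be the vector space with basis $S_0,\dots,S_s$. For $\rho\in\{0,\dots,s\}$ put $$\tilde W^\rho=(g^{\lambda\mu}g^{\nu\rho}-g^{\lambda\rho}g^{\mu\nu})\,S_\lambda\otimes S_\mu\otimes S_\nu\in\tilde E^{\otimes 3},$$ and let $\tilde R\subset\tilde E^{\otimes 3}$ be the linear span of $\tilde W^0,\dots,\tilde W^s$. Let $\tilde\varphi:\tilde R\to\mathbb K 1\oplus\tilde E\oplus\tilde E^{\otimes 2}$ be a linear map and write, for each $\rho\in\{0,\dots,s\}$, $$\tilde\varphi(\tilde W^\rho)=\tilde\jmath^{\,\alpha\beta\rho}\,S_\alpha\otimes S_\beta+\tilde\jmath^{\,\alpha\rho}\,S_\alpha+\tilde\jmath^{\,\rho}\,1,\qquad \tilde\jmath^{\,\alpha\beta\rho},\,\tilde\jmath^{\,\alpha\rho},\,\tilde\jmath^{\,\rho}\in\mathbb K.$$ Then the algebra $\tilde{\mathcal A}_{\tilde\varphi}=T(\tilde E)/(\{x-\tilde\varphi(x)\mid x\in\tilde R\})$ satisfies the PBW property if and only if there exist $b_\rho,\ \omega^{\alpha\beta}\in\mathbb K$ (indices in $\{0,\dots,s\}$) with $\omega^{\alpha\beta}=-\omega^{\beta\alpha}$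 such that for all $\alpha,\beta,\gamma\in\{0,\dots,s\}$ $$\begin{array}{lll}\tilde\jmath^{\,\alpha\beta\gamma}&=&(g^{\alpha\gamma}g^{\beta\rho}-g^{\beta\gamma}g^{\alpha\rho})b_\rho,\\ \tilde\jmath^{\,\alpha\beta}&=&\omega^{\alpha\beta},\\ \tilde\jmath^{\,\alpha}&=&-\tfrac12\,\omega^{\alpha\rho}b_\rho.\end{array}$$
   Context: Summation over repeated upper-lower indices (running over $\{0,\dots,s\}$) is understood. $T(\tilde E)$ is the tensor algebra of $\tilde E$ over $\mathbb K$, and $(X)$ denotes the two-sided ideal generated by a subset $X\subset T(\tilde E)$. The relations $\tilde W^\rho=0$ define the cubic super Yang-Mills algebra $\tilde{\mathcal A}=T(\tilde E)/(\tilde R)$; equivalently these are the relations $[g^{\lambda\mu}S_\lambda S_\mu,S_\nu]=0$ for $\nu\in\{0,\dots,s\}$. It is graded with each $S_\lambda$ in degree $1$. PBW property: let $F^n=\bigoplus_{0\le i\le n}\tilde E^{\otimes i}$ be the natural filtration of $T(\tilde E)$. The algebra $\tilde{\mathcal A}_{\tilde\varphi}$ is filtered by the images of the $F^n$; let $gr(\tilde{\mathcal A}_{\tilde\varphi})$ be the associated graded algebra. There is a canonical surjective graded algebra homomorphism $\tilde{\mathcal A}\to gr(\tilde{\mathcal A}_{\tilde\varphi})$ sending each generator $S_\lambda$ to its class in degree $1$. One says that $\tilde{\mathcal A}_{\tilde\varphi}$ satisfies the PBW property if this homomorphism is an isomorphism. *)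

(* Defs.v *)
From HB Require Import structures.
From mathcomp Require Import all_boot all_order all_algebra.
From mathcomp Require Import generic_quotient ring_quotient finmap.
From mathcomp Require Import boolp classical_sets functions.
From mathcomp Require Import monalg.

Set Implicit Arguments.
Unset Strict Implicit.
Unset Printing Implicit Defensive.

Import GRing.Theory.

Local Open Scope ring_scope.
Local Open Scope quotient_scope.

Section Submodule.
Variables (K : pzRingType) (V : lmodType K) (S : submodClosed V).

Record submod := Submod { submod_val : V; submodP : submod_val \in S }.

HB.instance Definition _ := [isSub for submod_val].
HB.instance Definition _ := [Choice of submod by <:].
HB.instance Definition _ := [SubChoice_isSubLmodule of submod by <:].
End Submodule.

HB.mixin Record isPzAlgebra (K : comPzRingType) A of GRing.PzRing A := {
  sc : K -> A;
  sc_subproof : zmod_morphism sc /\ monoid_morphism sc;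
  sc_comm : forall k x, sc k * x = x * sc k
}.

(* Associative unital K-algebras, presented by a ring morphism sc from K to
   the center. MathComp's lalgType/algType require 1 != 0, whereas quotients of
   the tensor algebra may be zero. *)
#[short(type="pzAlgType")]
HB.structure Definition PzAlgebra (K : comPzRingType) :=
  {A of isPzAlgebra K A & GRing.PzRing A}.

Section ScalarMorphism.
Variables (K : comPzRingType) (A : pzAlgType K).
HB.instance Definition _ := GRing.isZmodMorphism.Build K A (@sc K A) (sc_subproof.1).
HB.instance Definition _ := GRing.isMonoidMorphism.Build K A (@sc K A) (sc_subproof.2).
End ScalarMorphism.

Definition alg_hom (K : comPzRingType) (A B : pzAlgType K) (f : A -> B) : Prop :=
  [/\ zmod_morphism f, monoid_morphism f & forall k : K, f (sc k) = sc k].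

HB.mixin Record isTwoSided (A : pzRingType) (I : A -> bool) := {
  idealMl : forall a x, x \in I -> a * x \in I;
  idealMr : forall a x, x \in I -> x * a \in I
}.

#[short(type="twoSidedIdeal")]
HB.structure Definition TwoSidedIdeal (A : pzRingType) :=
  {I of GRing.isZmodClosed A I & isTwoSided A I}.

Section GeneratedIdeal.
Variables (A : pzRingType) (X : set A).

Definition ideal_gen : {pred A} :=
  fun x => `[< forall J : twoSidedIdeal A, (forall y, X y -> y \in J) -> x \in J >].

Fact ideal_gen_zmod_closed : zmod_closed ideal_gen.
Proof.
split=> [|x y /asboolP hx /asboolP hy]; apply/asboolP => J XJ; first exact: rpred0.
by rewrite rpredB ?hx ?hy.
Qed.
HB.instance Definition _ := GRing.isZmodClosed.Build A ideal_gen ideal_gen_zmod_closed.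

Fact ideal_genMl a x : x \in ideal_gen -> a * x \in ideal_gen.
Proof. by move=> /asboolP hx; apply/asboolP => J XJ; apply/idealMl/hx. Qed.
Fact ideal_genMr a x : x \in ideal_gen -> x * a \in ideal_gen.
Proof. by move=> /asboolP hx; apply/asboolP => J XJ; apply/idealMr/hx. Qed.
HB.instance Definition _ := isTwoSided.Build A ideal_gen ideal_genMl ideal_genMr.
End GeneratedIdeal.

Section QuotientAlgebra.
Variables (K : comPzRingType) (A : pzAlgType K) (I : twoSidedIdeal A).

Definition quot_alg := Quotient.quot I.
HB.instance Definition _ := GRing.Zmodule.on quot_alg.

Definition qproj (x : A) : quot_alg := \pi_(Quotient.quot I) x.

Lemma qprojP x y : reflect (qproj x = qproj y) (x - y \in I).
Proof. rewrite Quotient.idealrBE; exact: eqP. Qed.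

Lemma qproj_repr (a : quot_alg) : qproj (repr a) = a.
Proof. exact: reprK. Qed.

Lemma qproj_surj (a : quot_alg) : exists x, qproj x = a.
Proof. by exists (repr a); exact: qproj_repr. Qed.

Fact qproj_zmod_morphism : zmod_morphism qproj.
Proof. by move=> x y; rewrite /qproj raddfB. Qed.
HB.instance Definition _ := GRing.isZmodMorphism.Build A quot_alg qproj qproj_zmod_morphism.

Definition qone : quot_alg := qproj 1.
Definition qmul (a b : quot_alg) : quot_alg := qproj (repr a * repr b).
Definition qsc (k : K) : quot_alg := qproj (sc k).

Lemma qmulE x y : qmul (qproj x) (qproj y) = qproj (x * y).
Proof.
apply/qprojP.
have -> : repr (qproj x) * repr (qproj y) - x * y =
    (repr (qproj x) - x) * repr (qproj y) + x * (repr (qproj y) - y).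
  by rewrite mulrBl mulrBr addrA subrK.
by rewrite rpredD //; [apply: idealMr | apply: idealMl];
  apply/qprojP; rewrite qproj_repr.
Qed.

Fact qmulA : associative qmul.
Proof.
move=> a b c; case: (qproj_surj a) (qproj_surj b) (qproj_surj c) => x <- [y <-] [z <-].
by rewrite !qmulE mulrA.
Qed.
Fact qmul1 : left_id qone qmul.
Proof. by move=> a; case: (qproj_surj a) => x <-; rewrite qmulE mul1r. Qed.
Fact qmulr1 : right_id qone qmul.
Proof. by move=> a; case: (qproj_surj a) => x <-; rewrite qmulE mulr1. Qed.
Fact qmulDl : left_distributive qmul +%R.
Proof.
move=> a b c; case: (qproj_surj a) (qproj_surj b) (qproj_surj c) => x <- [y <-] [z <-].
by rewrite -raddfD !qmulE mulrDl raddfD.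
Qed.
Fact qmulDr : right_distributive qmul +%R.
Proof.
move=> a b c; case: (qproj_surj a) (qproj_surj b) (qproj_surj c) => x <- [y <-] [z <-].
by rewrite -raddfD !qmulE mulrDr raddfD.
Qed.
HB.instance Definition _ :=
  GRing.Zmodule_isPzRing.Build quot_alg qmulA qmul1 qmulr1 qmulDl qmulDr.

Fact qproj_monoid_morphism : monoid_morphism qproj.
Proof. by split=> // x y; rewrite -qmulE. Qed.
HB.instance Definition _ :=
  GRing.isMonoidMorphism.Build A quot_alg qproj qproj_monoid_morphism.

Fact qsc_subproof : zmod_morphism qsc /\ monoid_morphism qsc.
Proof.
have [scB [sc1 scM]] := @sc_subproof K A.
split; last split; rewrite /qsc ?sc1 ?rmorph1 // => k l.
  by rewrite scB rmorphB.
by rewrite scM rmorphM.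
Qed.
Fact qsc_comm k a : qsc k * a = a * qsc k.
Proof. by case: (qproj_surj a) => x <-; rewrite -!rmorphM /= sc_comm. Qed.
HB.instance Definition _ := isPzAlgebra.Build K quot_alg qsc_subproof qsc_comm.

Lemma qproj_alg_hom : alg_hom qproj.
Proof. by split; [exact: rmorphB | exact: qproj_monoid_morphism |]. Qed.
End QuotientAlgebra.

Record filtration (K : comPzRingType) (A : pzAlgType K) := Filtration {
  fil :> nat -> {pred A};
  fil_zmod : forall n, zmod_closed (fil n);
  fil_sc : forall k : K, sc k \in fil 0;
  filM : forall m n x y, x \in fil m -> y \in fil n -> x * y \in fil (m + n);
  filS : forall n, {subset fil n <= fil n.+1}
}.

Section AssociatedGraded.
Variables (K : comPzRingType) (A : pzAlgType K) (F : filtration A).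

HB.instance Definition _ n := GRing.isZmodClosed.Build A (F n) (fil_zmod F n).

(* The direct sum of the F n, as sequences of finite support. *)
Definition rees_pred : {pred nat -> A} :=
  fun u => `[< (forall n, u n \in F n) /\ exists N, forall n, (N <= n)%N -> u n = 0 >].

Lemma reesP u : reflect
  ((forall n, u n \in F n) /\ exists N, forall n, (N <= n)%N -> u n = 0)
  (u \in rees_pred).
Proof. exact: asboolP. Qed.

Fact rees_zmod_closed : zmod_closed rees_pred.
Proof.
split=> [|u v /reesP[uF [M uM]] /reesP[vF [N vN]]]; apply/reesP.
  by split=> [n|]; [exact: rpred0 | exists 0%N].
split=> [n|]; first by rewrite rpredB.
exists (maxn M N) => n; rewrite geq_max => /andP[Mn Nn].
by rewrite !fctE uM ?vN ?subr0.
Qed.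
HB.instance Definition _ := GRing.isZmodClosed.Build _ rees_pred rees_zmod_closed.

Record rees := Rees { rees_val :> nat -> A; rees_valP : rees_val \in rees_pred }.
HB.instance Definition _ := [isSub for rees_val].
HB.instance Definition _ := [Choice of rees by <:].
HB.instance Definition _ := [SubChoice_isSubZmodule of rees by <:].

Lemma rees_eqP (u v : rees) : (forall n, u n = v n) <-> u = v.
Proof. by split=> [uv|-> //]; apply/val_inj/funext. Qed.

Lemma rees_in (u : rees) n : u n \in F n.
Proof. by case: u => u /= /reesP[]. Qed.

Lemma rees_fin (u : rees) : exists N, forall n, (N <= n)%N -> u n = 0.
Proof. by case: u => u /= /reesP[]. Qed.

Lemma rees0 n : (0 : rees) n = 0. Proof. by []. Qed.
Lemma reesD (u v : rees) n : (u + v) n = u n + v n. Proof. by []. Qed.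
Lemma reesB (u v : rees) n : (u - v) n = u n - v n. Proof. by []. Qed.

Fact delta_subproof n x : x \in F n -> (fun m => if m == n then x else 0) \in rees_pred.
Proof.
move=> xF; apply/reesP; split=> [m|]; first by case: eqP => [->|_]; rewrite ?rpred0.
by exists n.+1 => m nm; rewrite gtn_eqF.
Qed.
Definition delta n x (xF : x \in F n) : rees := Rees (delta_subproof xF).

Lemma rees1_subproof : 1 \in F 0.
Proof. by have [_ [<- _]] := @sc_subproof K A; exact: fil_sc. Qed.
Definition rees_one : rees := delta rees1_subproof.

Fact rees_mul_subproof (u v : rees) :
  (fun n => \sum_(i < n.+1) u i * v (n - i)%N) \in rees_pred.
Proof.
apply/reesP; split=> [n|].
  apply: rpred_sum => i _; have := filM (rees_in u i) (rees_in v (n - i)%N).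
  by rewrite subnKC // -ltnS.
have [M uM] := rees_fin u; have [N vN] := rees_fin v.
exists (M + N)%N => n MNn; apply: big1 => i _.
have [Mi|iM] := leqP M i; first by rewrite uM ?mul0r.
rewrite vN ?mulr0 // leq_subRL; last by rewrite -ltnS.
by apply: leq_trans MNn; rewrite leq_add2r ltnW.
Qed.
Definition rees_mul (u v : rees) : rees := Rees (rees_mul_subproof u v).

Lemma rees_mulE u v n : rees_mul u v n = \sum_(i < n.+1) u i * v (n - i)%N.
Proof. by []. Qed.

Lemma rees_mulE_rev u v n : rees_mul u v n = \sum_(i < n.+1) u (n - i)%N * v i.
Proof.
rewrite rees_mulE (reindex_inj rev_ord_inj) /=.
by apply: eq_bigr => i _; rewrite subSS subKn // -ltnS.
Qed.

Fact rees_mulA : associative rees_mul.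
Proof.
move=> p q r; apply/rees_eqP=> i.
rewrite rees_mulE rees_mulE_rev.
pose coef3 j k := p j * (q (i - j - k)%N * r k).
transitivity (\sum_(j < i.+1) \sum_(k < i.+1 | (k <= i - j)%N) coef3 j k).
  apply: eq_bigr => j _; rewrite rees_mulE_rev big_distrr /=.
  by rewrite (big_ord_narrow_leq (leq_subr _ _)).
rewrite (exchange_big_dep predT) //=; apply: eq_bigr => k _.
transitivity (\sum_(j < i.+1 | (j <= i - k)%N) coef3 j k).
  apply: eq_bigl => j; rewrite -ltnS -(ltnS j) -!subSn ?leq_ord //.
  by rewrite -subn_gt0 -(subn_gt0 j) -!subnDA addnC.
rewrite (big_ord_narrow_leq (leq_subr _ _)) big_distrl /=.
by apply: eq_bigr => j _; rewrite /coef3 -!subnDA addnC mulrA.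
Qed.

Lemma deltaM x (xF : x \in F 0) (u : rees) n : rees_mul (delta xF) u n = x * u n.
Proof.
rewrite rees_mulE big_ord_recl subn0 /= big1 ?addr0 // => i _.
by rewrite mul0r.
Qed.
Lemma Mdelta x (xF : x \in F 0) (u : rees) n : rees_mul u (delta xF) n = u n * x.
Proof.
rewrite rees_mulE_rev big_ord_recl subn0 /= big1 ?addr0 // => i _.
by rewrite mulr0.
Qed.

Fact rees_mul1 : left_id rees_one rees_mul.
Proof. by move=> u; apply/rees_eqP => n; rewrite deltaM mul1r. Qed.
Fact rees_mulr1 : right_id rees_one rees_mul.
Proof. by move=> u; apply/rees_eqP => n; rewrite Mdelta mulr1. Qed.
Fact rees_mulDl : left_distributive rees_mul +%R.
Proof.
move=> u v w; apply/rees_eqP => n; rewrite reesD !rees_mulE -big_split /=.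
by apply: eq_bigr => i _; rewrite -mulrDl.
Qed.
Fact rees_mulDr : right_distributive rees_mul +%R.
Proof.
move=> u v w; apply/rees_eqP => n; rewrite reesD !rees_mulE -big_split /=.
by apply: eq_bigr => i _; rewrite -mulrDr.
Qed.
HB.instance Definition _ :=
  GRing.Zmodule_isPzRing.Build rees rees_mulA rees_mul1 rees_mulr1 rees_mulDl rees_mulDr.

Lemma reesM (u v : rees) n : (u * v) n = \sum_(i < n.+1) u i * v (n - i)%N.
Proof. by []. Qed.

Definition rees_sc (k : K) : rees := delta (fil_sc F k).
Fact rees_sc_subproof : zmod_morphism rees_sc /\ monoid_morphism rees_sc.
Proof.
have [scB [sc1 scM]] := @sc_subproof K A.
split; [|split] => [k l||k l]; apply/rees_eqP => n.
- by rewrite reesB /=; case: eqP; rewrite ?subr0.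
- by rewrite /= sc1.
by rewrite deltaM /=; case: eqP; rewrite ?mulr0.
Qed.
Fact rees_sc_comm k (u : rees) : rees_sc k * u = u * rees_sc k.
Proof. by apply/rees_eqP => n; rewrite deltaM Mdelta sc_comm. Qed.
HB.instance Definition _ := isPzAlgebra.Build K rees rees_sc_subproof rees_sc_comm.

Definition fil_pred (n : nat) : {pred A} := if n is m.+1 then F m else pred1 0.

(* The direct sum of the F (n - 1), with F (-1) = 0. *)
Definition shift_ideal : {pred rees} := fun u => `[< forall n, u n \in fil_pred n >].

Fact fil_pred_zmod n : zmod_closed (fil_pred n).
Proof.
case: n => [|n]; last exact: fil_zmod.
by split=> [|x y]; rewrite !inE // => /eqP-> /eqP->; rewrite subr0.
Qed.
HB.instance Definition _ n := GRing.isZmodClosed.Build A (fil_pred n) (fil_pred_zmod n).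

Lemma fil_predMl m n x y : x \in F m -> y \in fil_pred n -> x * y \in fil_pred (m + n).
Proof.
case: n => [|n] xF; last by rewrite addnS; exact: filM.
by rewrite inE => /eqP->; rewrite mulr0 rpred0.
Qed.
Lemma fil_predMr m n x y : x \in fil_pred m -> y \in F n -> x * y \in fil_pred (m + n).
Proof.
case: m => [|m] xF yF; last exact: filM.
by move: xF; rewrite inE => /eqP->; rewrite mul0r rpred0.
Qed.

Fact shift_ideal_zmod_closed : zmod_closed shift_ideal.
Proof.
split=> [|u v /asboolP uF /asboolP vF]; apply/asboolP => n; first exact: rpred0.
by rewrite reesB rpredB.
Qed.
HB.instance Definition _ :=
  GRing.isZmodClosed.Build rees shift_ideal shift_ideal_zmod_closed.

Fact shift_idealMl (v u : rees) : u \in shift_ideal -> v * u \in shift_ideal.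
Proof.
move=> /asboolP uF; apply/asboolP => n; rewrite reesM; apply: rpred_sum => i _.
by have := fil_predMl (rees_in v i) (uF (n - i)%N); rewrite subnKC // -ltnS.
Qed.
Fact shift_idealMr (v u : rees) : u \in shift_ideal -> u * v \in shift_ideal.
Proof.
move=> /asboolP uF; apply/asboolP => n; rewrite reesM; apply: rpred_sum => i _.
by have := fil_predMr (uF i) (rees_in v (n - i)%N); rewrite subnKC // -ltnS.
Qed.
HB.instance Definition _ := isTwoSided.Build rees shift_ideal shift_idealMl shift_idealMr.

(* The direct sum of the F n / F (n - 1), with the induced product. *)
Definition gr : pzAlgType K := quot_alg shift_ideal.

Definition gr_class n x (xF : x \in F n) : gr := qproj shift_ideal (delta xF).
End AssociatedGraded.

Arguments shift_ideal {K A} F _.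
Arguments gr_class {K A} F n x xF.

Definition word (n : nat) := seq 'I_n.
HB.instance Definition _ n := Choice.on (word n).

Fact word_unit n (v w : word n) : v ++ w = [::] -> v = [::] /\ w = [::].
Proof. by case: v w => [|? ?] [|? ?]. Qed.
HB.instance Definition _ n := Choice_isMonomialDef.Build (word n)
  (@catA 'I_n) (@cat0s 'I_n) (@cats0 'I_n) (@word_unit n).

(* The tensor algebra of K^n, as the monoid algebra of the words in the basis
   S_0, ..., gen(n-1): the tensor product of tensors is the product in it. *)
Definition tens (K : fieldType) (n : nat) := {malg K[word n]}.

HB.instance Definition _ (K : fieldType) n := GRing.Lalgebra.on (tens K n).

Section TensorAlgebra.
Variables (K : fieldType) (n : nat).
Local Notation T := (tens K n).

Definition tens_sc (k : K) : T := k%:MP.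
Fact tens_sc_subproof : zmod_morphism tens_sc /\ monoid_morphism tens_sc.
Proof.
split; [|split] => [k l||k l]; rewrite /tens_sc ?raddfB //.
exact: mpolyCM.
Qed.
Fact tens_sc_comm k (x : T) : tens_sc k * x = x * tens_sc k.
Proof.
rewrite !malgM_def fgmulUg fgmulgU; apply: eq_bigr => w _.
by rewrite mulrC mul1m mulm1.
Qed.
HB.instance Definition _ := isPzAlgebra.Build K T tens_sc_subproof tens_sc_comm.

Lemma tens_scE (k : K) (x : T) : sc k * x = k *: x.
Proof. exact: mul_malgC. Qed.

Lemma mcoeff_sc (k : K) (w : word n) : (sc k : T)@_w = k *+ (w == [::]).
Proof. exact: mcoeffC. Qed.

Definition gen (i : 'I_n) : T := << [:: i] : word n >>.

Definition homog (d : nat) : {pred T} := fun x => all (fun w => size w == d) (msupp x).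

(* The direct sum of the tensors of degree i, for i <= d. *)
Definition tens_fil (d : nat) : {pred T} :=
  fun x => all (fun w => (size w <= d)%N) (msupp x).

Lemma homogP d x : reflect (forall w, size w != d -> x@_w = 0) (x \in homog d).
Proof.
apply: (iffP allP) => [xd w wd|xd w].
  by apply/mcoeff_outdom/negP => /xd; rewrite (negPf wd).
by rewrite -mcoeff_neq0; apply: contra_neqT => /xd.
Qed.

Lemma tens_filP d x : reflect (forall w, (d < size w)%N -> x@_w = 0) (x \in tens_fil d).
Proof.
apply: (iffP allP) => [xd w wd|xd w].
  by apply/mcoeff_outdom/negP => /xd; rewrite leqNgt wd.
by rewrite -mcoeff_neq0 leqNgt; apply: contra_neqN => /xd.
Qed.

Lemma sc_homog (k : K) : sc k \in homog 0.
Proof. by apply/homogP => -[|? ?] //; rewrite mcoeff_sc. Qed.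

Lemma gen_homog i : gen i \in homog 1.
Proof. by apply/homogP => w; rewrite mcoeffU; case: ([:: i] =P w) => [<-|]. Qed.

Lemma homogM i j x y : x \in homog i -> y \in homog j -> x * y \in homog (i + j).
Proof.
move=> xi yj; apply/allP => w wxy.
have [v [u [vx uy ->]]] := @msuppM_le (word n) K x y w wxy.
by rewrite size_cat (eqP (allP xi _ vx)) (eqP (allP yj _ uy)).
Qed.

Fact homog_submod d : submod_closed (homog d).
Proof.
split=> [|k x y /homogP xd /homogP yd]; apply/homogP => w wd.
  by rewrite mcoeff0.
by rewrite mcoeffD mcoeffZ xd ?yd // mulr0 addr0.
Qed.
HB.instance Definition _ d := GRing.isSubmodClosed.Build K T (homog d)
  (GRing.submod_closed_semi (homog_submod d)).

Lemma homog_fil d x : x \in homog d -> x \in tens_fil d.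
Proof.
by move/homogP => xd; apply/tens_filP => w wd; rewrite xd // gtn_eqF.
Qed.

Fact tens_fil_submod d : submod_closed (tens_fil d).
Proof.
split=> [|k x y /tens_filP xd /tens_filP yd]; apply/tens_filP => w wd.
  by rewrite mcoeff0.
by rewrite mcoeffD mcoeffZ xd ?yd // mulr0 addr0.
Qed.
HB.instance Definition _ d := GRing.isSubmodClosed.Build K T (tens_fil d)
  (GRing.submod_closed_semi (tens_fil_submod d)).

Lemma tens_filM i j x y : x \in tens_fil i -> y \in tens_fil j -> x * y \in tens_fil (i + j).
Proof.
move=> xi yj; apply/allP => w wxy.
have [v [u [vx uy ->]]] := @msuppM_le (word n) K x y w wxy.
by rewrite size_cat leq_add ?(allP xi) ?(allP yj).
Qed.

(* The component of degree d. *)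
Definition hcomp (d : nat) (x : T) : T :=
  [malg w in msupp x => if size w == d then x@_w else 0].

Lemma hcompE d x w : (hcomp d x)@_w = if size w == d then x@_w else 0.
Proof.
rewrite mcoeffE; case: ifP => // /negbT; rewrite -mcoeff_eq0 => /eqP ->.
by rewrite if_same.
Qed.

Fact hcomp_zmod_morphism d : zmod_morphism (hcomp d).
Proof.
move=> x y; apply/malgP => w; rewrite mcoeffB !hcompE mcoeffB.
by case: eqP; rewrite ?subr0.
Qed.
HB.instance Definition _ d := GRing.isZmodMorphism.Build T T (hcomp d) (hcomp_zmod_morphism d).

Lemma hcompU d (c : K) (w : word n) :
  hcomp d << c *g w >> = if size w == d then << c *g w >> else 0.
Proof.
apply/malgP => v; rewrite hcompE mcoeffU.
have [<-|wv] := eqVneq w v; first by case: ifP; rewrite ?mcoeffUU ?mcoeff0.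
by rewrite if_same; case: ifP; rewrite ?mcoeff0 // mcoeffU (negPf wv).
Qed.

Lemma hcomp_homog d x : hcomp d x \in homog d.
Proof. by apply/homogP => w /negPf wd; rewrite hcompE wd. Qed.

Lemma hcomp_id d e x : x \in homog e -> hcomp d x = if d == e then x else 0.
Proof.
move/homogP => xe; apply/malgP => w; rewrite hcompE.
have [->|de] := eqVneq d e; first by case: ifP => // /negbT /xe.
by rewrite mcoeff0; case: eqP => // wd; rewrite xe // wd.
Qed.

Lemma hcomp_fin x : exists N, forall d, (N <= d)%N -> hcomp d x = 0.
Proof.
exists (\max_(w <- msupp x) (size w)).+1 => d xd.
apply/malgP => w; rewrite hcompE mcoeff0; case: eqP => // wd.
apply/mcoeff_outdom/negP => wx; move: xd; rewrite -wd ltnNge.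
by rewrite (big_fsetD1 _ wx) /= leq_maxl.
Qed.

Lemma hcompM d x y : hcomp d (x * y) = \sum_(i < d.+1) hcomp i x * hcomp (d - i) y.
Proof.
transitivity (\sum_(v <- msupp x) \sum_(w <- msupp y)
    \sum_(i < d.+1) hcomp i << x@_v *g v >> * hcomp (d - i) << y@_w *g w >>).
  rewrite malgME raddf_sum; apply: eq_bigr => v _; rewrite raddf_sum.
  apply: eq_bigr => w _ /=; rewrite hcompU size_cat.
  case: eqP => [vw|vw].
    have wd : (d - size v)%N = size w by rewrite -vw addKn.
    have vd : (size v < d.+1)%N by rewrite ltnS -vw leq_addr.
    rewrite (bigD1 (Ordinal vd)) //= !hcompU wd !eqxx.
    rewrite [X in _ + X]big1 ?addr0 => [|i]; first exact/esym/fgmulUU.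
    by rewrite -val_eqE /= eq_sym => /negPf iv; rewrite hcompU iv mul0r.
  rewrite big1 // => i _; rewrite !hcompU; case: eqP => [vi|]; last by rewrite mul0r.
  case: eqP => [wi|]; last by rewrite mulr0.
  by case: vw; rewrite vi wi subnKC // -ltnS.
transitivity (\sum_(v <- msupp x) \sum_(i < d.+1) \sum_(w <- msupp y)
    hcomp i << x@_v *g v >> * hcomp (d - i) << y@_w *g w >>).
  by apply: eq_bigr => v _; exact: exchange_big.
rewrite exchange_big; apply: eq_bigr => i _.
rewrite [in RHS](monalgE x) [in RHS](monalgE y) !raddf_sum mulr_suml.
by apply: eq_bigr => v _; rewrite mulr_sumr.
Qed.

Section ImageFiltration.
Variable I : twoSidedIdeal T.

Definition img_fil (d : nat) : {pred quot_alg I} :=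
  fun a => `[< exists2 x, x \in tens_fil d & a = qproj I x >].

Lemma img_fil_qproj d x : x \in tens_fil d -> qproj I x \in img_fil d.
Proof. by move=> xd; apply/asboolP; exists x. Qed.

Fact img_fil_zmod d : zmod_closed (img_fil d).
Proof.
split=> [|a b /asboolP[x xd ->] /asboolP[y yd ->]].
  by rewrite -(raddf0 (qproj I)) img_fil_qproj ?rpred0.
by rewrite -rmorphB img_fil_qproj ?rpredB.
Qed.
Fact img_fil_sc (k : K) : sc k \in img_fil 0.
Proof.
apply: img_fil_qproj; apply/tens_filP => w w0.
exact: (homogP _ _ (sc_homog k) _ (lt0n_neq0 w0)).
Qed.
Fact img_filM i j a b : a \in img_fil i -> b \in img_fil j -> a * b \in img_fil (i + j).
Proof.
move=> /asboolP[x xi ->] /asboolP[y yj ->].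
by rewrite -rmorphM img_fil_qproj // tens_filM.
Qed.
Fact img_filS d : {subset img_fil d <= img_fil d.+1}.
Proof.
move=> _ /asboolP[x /tens_filP xd ->]; apply: img_fil_qproj.
by apply/tens_filP => w /ltnW; exact: xd.
Qed.
Definition img_filtration : filtration (quot_alg I) :=
  Filtration img_fil_zmod img_fil_sc img_filM img_filS.

Fact hseq_subproof (x : T) : (fun d => qproj I (hcomp d x)) \in rees_pred img_filtration.
Proof.
apply/reesP; split=> [d|]; first exact/img_fil_qproj/homog_fil/hcomp_homog.
by have [N xN] := hcomp_fin x; exists N => d Nd; rewrite xN ?raddf0.
Qed.
Definition hseq (x : T) : rees img_filtration := Rees (hseq_subproof x).

Lemma hseq_alg_hom : alg_hom hseq.
Proof.
split=> [x y||k]; [|split=> [|x y]|]; apply/rees_eqP => d.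
- by rewrite reesB /= !raddfB.
- rewrite /= (@hcomp_id d 0); last by rewrite -(rmorph1 (@sc K T)) sc_homog.
  by case: eqP; rewrite ?rmorph0 ?rmorph1.
- rewrite reesM /= hcompM rmorph_sum; apply: eq_bigr => i _; exact: rmorphM.
rewrite /= (@hcomp_id d 0); last exact: sc_homog.
by case: eqP; rewrite ?rmorph0.
Qed.
End ImageFiltration.
End TensorAlgebra.

Section CubicAlgebra.
Variables (K : fieldType) (n : nat) (g : 'M[K]_n).
Local Notation T := (tens K n).
Let G := invmx g.

(* The entries of invmx g are the g^{lam mu}. *)
Definition cubicW (rho : 'I_n) : T := \sum_lam \sum_mu \sum_nu
  (G lam mu * G nu rho - G lam rho * G mu nu) *: (gen K lam * gen K mu * gen K nu).

Definition cubic_span : {pred T} :=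
  fun x => `[< exists c : 'I_n -> K, x = \sum_rho c rho *: cubicW rho >].

Fact cubic_span_submod : submod_closed cubic_span.
Proof.
split=> [|k x y /asboolP[c ->] /asboolP[d ->]]; apply/asboolP.
  by exists (fun=> 0); rewrite big1 // => i _; rewrite scale0r.
exists (fun i => k * c i + d i); rewrite scaler_sumr -big_split /=.
by apply: eq_bigr => i _; rewrite scalerDl scalerA.
Qed.
HB.instance Definition _ := GRing.isSubmodClosed.Build K T cubic_span
  (GRing.submod_closed_semi cubic_span_submod).

Fact cubicW_in_span rho : cubicW rho \in cubic_span.
Proof.
apply/asboolP; exists (fun i => (i == rho)%:R).
rewrite (bigD1 rho) //= eqxx scale1r big1 ?addr0 // => i /negPf ->.
by rewrite scale0r.
Qed.

Definition cubicW_sub (rho : 'I_n) : submod cubic_span := Submod (cubicW_in_span rho).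

Definition cubic_alg := quot_alg (ideal_gen [set x | x \in cubic_span]).

Variable phi : {linear submod cubic_span -> submod (@tens_fil K n 2)}.

Definition deformed_rel : set T :=
  [set submod_val x - submod_val (phi x) | x in [set: submod cubic_span]].

Definition deformed_alg := quot_alg (ideal_gen deformed_rel).

Local Notation J := (ideal_gen deformed_rel).
Local Notation F := (img_filtration J).

Lemma cubic_span_homog x : x \in cubic_span -> x \in homog 3.
Proof.
move=> /asboolP[c ->]; apply: rpred_sum => r _; apply: rpredZ.
do 3![apply: rpred_sum => ? _]; apply: rpredZ.
by apply: (@homogM _ _ 2 1); [apply: (@homogM _ _ 1 1)|]; exact: gen_homog.
Qed.

Definition hseq_ker : {pred T} := fun x => hseq J x \in shift_ideal F.

Lemma hseq_kerE x : (x \in hseq_ker) = (hseq J x \in shift_ideal F).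
Proof. by []. Qed.

Fact hseq_ker_zmod_closed : zmod_closed hseq_ker.
Proof.
have [hB _ _] := hseq_alg_hom J; split=> [|x y ]; rewrite !hseq_kerE.
  by rewrite -(subrr 0) hB subrr rpred0.
by move=> xk yk; rewrite hB rpredB.
Qed.
HB.instance Definition _ := GRing.isZmodClosed.Build T hseq_ker hseq_ker_zmod_closed.

Fact hseq_kerMl a x : x \in hseq_ker -> a * x \in hseq_ker.
Proof. by have [_ [_ hM] _] := hseq_alg_hom J; rewrite !hseq_kerE hM; exact: idealMl. Qed.
Fact hseq_kerMr a x : x \in hseq_ker -> x * a \in hseq_ker.
Proof. by have [_ [_ hM] _] := hseq_alg_hom J; rewrite !hseq_kerE hM; exact: idealMr. Qed.
HB.instance Definition _ := isTwoSided.Build T hseq_ker hseq_kerMl hseq_kerMr.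

Lemma cubic_span_ker x : x \in cubic_span -> x \in hseq_ker.
Proof.
move=> xW; rewrite hseq_kerE; apply/asboolP => d /=.
rewrite (hcomp_id d (cubic_span_homog xW)); case: eqP => [->|_]; last first.
  by rewrite raddf0 rpred0.
suff -> : qproj J x = qproj J (submod_val (phi (Submod xW))).
  exact/img_fil_qproj/submodP.
by apply/qprojP/asboolP => I; apply; exists (Submod xW).
Qed.

(* The class of x is sent to the sum over d of the classes in degree d of the
   images of the homogeneous components of x: see canonical_mapE,
   canonical_map_alg_hom, canonical_map_homog and canonical_map_surj. *)
Definition canonical_map (a : cubic_alg) : gr F := qproj (shift_ideal F) (hseq J (repr a)).

Lemma canonical_mapE x :
  canonical_map (qproj (ideal_gen [set x | x \in cubic_span]) x) =
  qproj (shift_ideal F) (hseq J x).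
Proof.
have [hB _ _] := hseq_alg_hom J; apply/qprojP; rewrite -hB.
have /qprojP/asboolP/(_ hseq_ker cubic_span_ker) :=
  qproj_repr (qproj (ideal_gen [set x | x \in cubic_span]) x).
by [].
Qed.

Lemma canonical_map_alg_hom : alg_hom canonical_map.
Proof.
have [hB [h1 hM] hsc] := hseq_alg_hom J.
split=> [a b||k]; [|split=> [|a b]|].
- case: (qproj_surj a) (qproj_surj b) => x <- [y <-].
  by rewrite -rmorphB /= !canonical_mapE hB rmorphB.
- by rewrite [LHS]canonical_mapE h1.
- case: (qproj_surj a) (qproj_surj b) => x <- [y <-].
  by rewrite -rmorphM /= !canonical_mapE hM rmorphM.
by rewrite [LHS]canonical_mapE hsc.
Qed.

Lemma canonical_map_homog d x (xd : x \in homog d) :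
  canonical_map (qproj _ x) =
  gr_class F d (qproj J x) (img_fil_qproj J (homog_fil xd)).
Proof.
rewrite canonical_mapE; congr qproj; apply/rees_eqP => e /=.
by rewrite (hcomp_id e xd); case: eqP; rewrite ?raddf0.
Qed.

Lemma canonical_map_gen i :
  canonical_map (qproj _ (gen K i)) =
  gr_class F 1 (qproj J (gen K i)) (img_fil_qproj J (homog_fil (gen_homog K i))).
Proof. exact: canonical_map_homog. Qed.

Lemma canonical_map_surj (a : gr F) : exists x, canonical_map x = a.
Proof.
have [u <-] := qproj_surj a; have [N uN] := rees_fin u.
have /choice[y yP] d : exists y, y \in tens_fil d /\ u d = qproj J y.
  by have /asboolP[y] := rees_in u d; exists y.
exists (qproj _ (\sum_(d < N) hcomp d (y d))); rewrite canonical_mapE.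
apply/qprojP/asboolP => e; rewrite reesB /=.
have -> : hcomp e (\sum_(d < N) hcomp d (y d)) =
          if (e < N)%N then hcomp e (y e) else 0.
  rewrite raddf_sum /=; case: ifP => [eN|/negP eN].
    rewrite (bigD1 (Ordinal eN)) //= (hcomp_id e (hcomp_homog _ _)) eqxx.
    rewrite big1 ?addr0 // => d /negP de; rewrite (hcomp_id e (hcomp_homog _ _)).
    by case: eqP => // ed; case: de; apply/eqP/val_inj.
  rewrite big1 // => d _; rewrite (hcomp_id e (hcomp_homog _ _)).
  by case: eqP => // ed; case: eN; rewrite ed.
case: ifP => [eN|/negbT]; last by rewrite -leqNgt => /uN ->; rewrite raddf0 subrr rpred0.
have [ye ->] := yP e; rewrite -raddfB /=; case: e ye {eN} => [|e] ye /=.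
  suff -> : hcomp 0 (y 0%N) = y 0%N by rewrite subrr raddf0 inE.
  apply/malgP => w; rewrite hcompE; case: eqP => // /eqP w0.
  by rewrite (tens_filP _ _ ye) // lt0n.
apply: img_fil_qproj; apply/tens_filP => w ew; rewrite mcoeffB hcompE.
case: eqP => [_|/eqP we]; first by rewrite subrr.
by rewrite (tens_filP _ _ ye) ?subrr // ltn_neqAle eq_sym we.
Qed.

Definition PBW : Prop := bijective canonical_map.

End CubicAlgebra.

(* Main.v *)
(** Write Q for g^{lambda mu} S_lambda S_mu, S^i for g^{li} S_l, and
    W_i = [Q, S_i], which spans the same space as the W^rho. Since S_i Q S^i =
    S^i Q S_i, there is one overlap: sum_i (W_i S^i + S^i W_i) = 0. Hence in the
    deformed algebra z = sum_rho (phi(W^rho) S_rho + S_rho phi(W^rho)) vanishes,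
    and PBW forces z to be a combination of the W^rho - phi(W^rho). Comparing
    coefficients degree by degree gives four equations, whose solutions (2 being
    invertible) are the ones in the theorem.

    Conversely the overlap generates all syzygies: if sum_i v_i W_i lies in I E,
    where I is the cubic ideal and E the span of the S_i, then v_i = e S^i modulo
    I for some e. For s > 0 this Koszul exactness is proved by induction on the
    degree, splitting off the last letter, from two cancellation properties:
    nonzero linear elements can be cancelled on the right in T/(Q), and Q can be
    cancelled in the cubic algebra (for s = 0 the W_i vanish). So when z is such a combination, every element of the
    deformed ideal which drops in degree has a presentation of lower degree. *)

Require Import Defs.
From HB Require Import structures.
From mathcomp Require Import all_boot all_order all_algebra.
From mathcomp Require Import ring.
From mathcomp Require Import finmap boolp classical_sets.
From mathcomp Require Import monalg.

Set Implicit Arguments.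
Unset Strict Implicit.
Unset Printing Implicit Defensive.

Import GRing.Theory.
Local Open Scope ring_scope.

Section SubmodTheory.
Variables (K : pzRingType) (V : lmodType K) (P : submodClosed V).

Lemma submodN x : x \in P -> - x \in P.
Proof. by rewrite -scaleN1r; exact: rpredZ. Qed.

Lemma submodB x y : x \in P -> y \in P -> x - y \in P.
Proof. by move=> xP /submodN; exact: rpredD. Qed.

End SubmodTheory.

Section IdealInduction.
Variables (A : pzRingType) (X : set A) (P : A -> Prop).
Hypotheses (P0 : P 0) (PB : forall x y, P x -> P y -> P (x - y)).
Hypotheses (PMl : forall a x, P x -> P (a * x)) (PMr : forall a x, P x -> P (x * a)).
Hypothesis XP : forall x, X x -> P x.

Let I : {pred A} := fun x => `[< P x >].

Fact ideal_ind_zmod_closed : zmod_closed I.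
Proof. by split=> [|x y /asboolP Px /asboolP Py]; apply/asboolP; [|exact: PB]. Qed.
Fact ideal_ind_Ml a x : x \in I -> a * x \in I.
Proof. by move=> /asboolP Px; apply/asboolP/PMl. Qed.
Fact ideal_ind_Mr a x : x \in I -> x * a \in I.
Proof. by move=> /asboolP Px; apply/asboolP/PMr. Qed.
HB.instance Definition _ := GRing.isZmodClosed.Build A I ideal_ind_zmod_closed.
HB.instance Definition _ := isTwoSided.Build A I ideal_ind_Ml ideal_ind_Mr.

Lemma ideal_gen_ind x : x \in ideal_gen X -> P x.
Proof. by move=> /asboolP/(_ I) xI; apply/asboolP/xI => y /XP Py; exact/asboolP. Qed.

End IdealInduction.

Lemma mulmx1_comb (K : fieldType) (n : nat) (V : lmodType K) (M N : 'M[K]_n)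
    (x : 'I_n -> V) i :
  M *m N = 1%:M -> \sum_r N r i *: \sum_l M l r *: x l = x i.
Proof.
move=> MN; under eq_bigr => r _ do rewrite scaler_sumr.
rewrite exchange_big /=.
have coef l : \sum_r N r i *: (M l r *: x l) = (l == i)%:R *: x l.
  under eq_bigr => r _ do rewrite scalerA mulrC.
  by rewrite -scaler_suml; have /matrixP/(_ l i) := MN; rewrite !mxE => ->.
under eq_bigr => l _ do rewrite coef.
rewrite (bigD1 i) //= eqxx scale1r big1 ?addr0 // => l /negPf->.
by rewrite scale0r.
Qed.

Section Levels.
Variables (K : fieldType) (n : nat) (A : algType K) (S : 'I_n -> A).
Variables (m : nat) (F : nat -> submodClosed A) (p : 'I_m -> A).

(* The span of the u * p r * v with deg u + deg v < k when F is a filtration, and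
   with deg u + deg v = k - 1 when F is a grading. *)
Fixpoint level (k : nat) : {pred A} :=
  if k is j.+1 then fun x => `[< exists (u : 'I_n -> A) (v : 'I_m -> A),
    [/\ forall i, u i \in level j, forall r, v r \in F j &
        x = \sum_i u i * S i + \sum_r v r * p r] >]
  else pred1 0.

Lemma level0 x : x \in level 0 -> x = 0.
Proof. by move/eqP. Qed.

Lemma levelP k x : reflect (exists (u : 'I_n -> A) (v : 'I_m -> A),
    [/\ forall i, u i \in level k, forall r, v r \in F k &
        x = \sum_i u i * S i + \sum_r v r * p r]) (x \in level k.+1).
Proof. exact: asboolP. Qed.

Fact level_submod k : submod_closed (level k).
Proof.
elim: k => [|k [IH0 IH]].
  by split=> [|a x y /eqP-> /eqP->]; rewrite inE // scaler0 addr0.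
split=> [|a x y /levelP[u [v [uk vk ->]]] /levelP[u' [v' [uk' vk' ->]]]].
  apply/levelP; exists (fun=> 0), (fun=> 0).
  by split=> // [r|]; rewrite ?rpred0 // !big1 ?addr0 // => i _; rewrite mul0r.
apply/levelP; exists (fun i => a *: u i + u' i), (fun r => a *: v r + v' r).
split=> [i|r|]; [exact: IH | by rewrite rpredD ?rpredZ |].
rewrite scalerDr addrACA !scaler_sumr -!big_split /=.
by congr (_ + _); apply: eq_bigr => i _; rewrite mulrDl scalerAl.
Qed.
HB.instance Definition _ k := GRing.isSubmodClosed.Build K A (level k)
  (GRing.submod_closed_semi (level_submod k)).

Lemma level_sumS k (u : 'I_n -> A) :
  (forall i, u i \in level k) -> \sum_i u i * S i \in level k.+1.
Proof.
move=> uk; apply/levelP; exists u, (fun=> 0); split=> // [r|]; rewrite ?rpred0 //.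
by rewrite [X in _ + X]big1 ?addr0 // => r _; rewrite mul0r.
Qed.

Lemma level_sump k (v : 'I_m -> A) :
  (forall r, v r \in F k) -> \sum_r v r * p r \in level k.+1.
Proof.
move=> vk; apply/levelP; exists (fun=> 0), v; split=> // [r|]; rewrite ?rpred0 //.
by rewrite [X in X + _]big1 ?add0r // => r _; rewrite mul0r.
Qed.

Lemma level_mulS k x i : x \in level k -> x * S i \in level k.+1.
Proof.
move=> xk; have -> : x * S i = \sum_j (if j == i then x else 0) * S j.
  by rewrite (bigD1 i) //= eqxx big1 ?addr0 // => j /negPf->; rewrite mul0r.
by apply: level_sumS => j; case: ifP => // _; rewrite rpred0.
Qed.

Lemma level_mulp k x r : x \in F k -> x * p r \in level k.+1.
Proof.
move=> xk; have -> : x * p r = \sum_j (if j == r then x else 0) * p j.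
  by rewrite (bigD1 r) //= eqxx big1 ?addr0 // => j /negPf->; rewrite mul0r.
by apply: level_sump => j; case: ifP => // _; rewrite rpred0.
Qed.

Lemma level_pred_mulS k x i : x \in level k.-1 -> x * S i \in level k.
Proof. case: k => [/level0->|k]; [by rewrite mul0r rpred0 | exact: level_mulS]. Qed.

Hypothesis FM : forall d e x y, x \in F d -> y \in F e -> x * y \in F (d + e)%N.

Lemma level_eq0 k x : (forall r, p r = 0) -> x \in level k -> x = 0.
Proof.
move=> p0; elim: k x => [|k IH] x; first exact: level0.
move=> /levelP[u [v [uk _ ->]]]; rewrite !big1 ?addr0 // => i _.
  by rewrite p0 mulr0.
by rewrite (IH _ (uk i)) mul0r.
Qed.

Lemma level_ideal (I : twoSidedIdeal A) k x :
  (forall r, p r \in I) -> x \in level k -> x \in I.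
Proof.
move=> pI; elim: k x => [|k IH] x; first by move/level0->; exact: rpred0.
move=> /levelP[u [v [uk _ ->]]]; rewrite rpredD ?rpred_sum // => i _.
  by apply/Defs.idealMr/IH.
exact/Defs.idealMl/pI.
Qed.

Lemma level_mull d k a x : a \in F d -> x \in level k -> a * x \in level (d + k).
Proof.
move=> ad; elim: k x => [|k IH] x; first by move/level0->; rewrite mulr0 rpred0.
move=> /levelP[u [v [uk vk ->]]]; rewrite addnS mulrDr !mulr_sumr rpredD //.
  under eq_bigr => i _ do rewrite mulrA.
  by apply: level_sumS => i; exact: IH.
under eq_bigr => r _ do rewrite mulrA.
by apply: level_sump => r; exact: FM.
Qed.

Hypothesis FS : forall d, {subset F d <= F d.+1}.

Lemma levelS k : {subset level k <= level k.+1}.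
Proof.
elim: k => [|k IH] x; first by move/level0->; exact: rpred0.
move=> /levelP[u [v [uk vk ->]]].
by apply/levelP; exists u, v; split=> // [i|r]; [exact: IH | exact: FS].
Qed.

Lemma level_le j k : (j <= k)%N -> {subset level j <= level k}.
Proof.
move=> /subnK<-; elim: (k - j)%N => [|i IH] x xj //.
by rewrite addSn; apply/levelS/IH.
Qed.

End Levels.

(* A stands for the tensor algebra: D i strips the last letter S i (and kills
   the words not ending in it), hom and fil are the homogeneous parts and the
   filtration, and top d is the component of degree d. Keeping A abstract prevents
   unification from unfolding the product of the monoid algebra. *)
Section Cubic.
Variables (K : fieldType) (n : nat) (A : algType K) (S : 'I_n -> A).
Variables (hom : nat -> submodClosed A) (D : 'I_n -> {linear A -> A}).
Hypothesis homM : forall d e x y, x \in hom d -> y \in hom e -> x * y \in hom (d + e)%N.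
Hypothesis S_hom : forall i, S i \in hom 1.
Hypothesis D_mulS : forall i x j, D i (x * S j) = if j == i then x else 0.
Variable G : 'M[K]_n.
Hypotheses (G_sym : G^T = G) (G_unit : G \in unitmx).

Definition up (i : 'I_n) : A := \sum_l G l i *: S l.
Definition quad : A := \sum_i up i * S i.
Definition rel (i : 'I_n) : A := quad * S i - S i * quad.

Lemma G_symE i j : G i j = G j i.
Proof. by rewrite -[in LHS]G_sym mxE. Qed.

Lemma D_sumS i (u : 'I_n -> A) : D i (\sum_j u j * S j) = u i.
Proof.
rewrite raddf_sum (bigD1 i) //= D_mulS eqxx big1 ?addr0 // => j /negPf ji.
by rewrite D_mulS ji.
Qed.

Lemma sumS_up (u : 'I_n -> A) : \sum_i up i * u i = \sum_i S i * \sum_l G i l *: u l.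
Proof.
under eq_bigr => i _ do rewrite mulr_suml.
rewrite exchange_big /=; apply: eq_bigr => l _; rewrite mulr_sumr.
by apply: eq_bigr => i _; rewrite -scalerAl scalerAr.
Qed.

Lemma quadE : quad = \sum_i S i * up i.
Proof.
rewrite /quad sumS_up; apply: eq_bigr => i _; congr (_ * _).
by apply: eq_bigr => l _; rewrite G_symE.
Qed.

Lemma D_quad i x : D i (x * quad) = x * up i.
Proof.
rewrite mulr_sumr; under eq_bigr => j _ do rewrite mulrA.
exact: D_sumS.
Qed.

Lemma D_rel (v : 'I_n -> A) i :
  D i (\sum_j v j * rel j) = v i * quad - (\sum_j v j * S j) * up i.
Proof.
under eq_bigr => j _ do rewrite mulrBr !mulrA.
by rewrite sumrB raddfB -mulr_suml /= D_quad D_sumS.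
Qed.

Lemma rel_overlap : \sum_i (rel i * up i + up i * rel i) = 0.
Proof.
rewrite big_split /=.
under eq_bigr => i _ do rewrite mulrBl -mulrA.
under [X in _ + X]eq_bigr => i _ do rewrite mulrBr [up i * (S i * _)]mulrA.
rewrite !sumrB -mulr_sumr -mulr_suml -/quad -quadE.
suff -> : \sum_i up i * (quad * S i) = \sum_i S i * quad * up i.
  by rewrite addrA subrK subrr.
rewrite sumS_up; apply: eq_bigr => i _; rewrite -mulrA; congr (_ * _).
rewrite mulr_sumr; apply: eq_bigr => l _; by rewrite G_symE scalerAr.
Qed.

Lemma rel_eq0 i : (n <= 1)%N -> rel i = 0.
Proof.
move=> n1; have all_eq (j : 'I_n) : j = i.
  have ord0_ k : val (k : 'I_n) = 0%N.
    by apply/eqP; rewrite -leqn0 -ltnS (leq_trans (ltn_ord k)).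
  by apply: val_inj; rewrite !ord0_.
rewrite /rel /quad /up; apply/eqP; rewrite subr_eq0; apply/eqP.
rewrite mulr_suml mulr_sumr; apply: eq_bigr => k _.
rewrite !mulr_suml mulr_sumr; apply: eq_bigr => l _.
by rewrite (all_eq l) (all_eq k) -!scalerAl -scalerAr mulrA.
Qed.

Lemma up_quad i : quad * up i - up i * quad = \sum_l G l i *: rel l.
Proof.
rewrite mulr_sumr mulr_suml -sumrB; apply: eq_bigr => l _.
by rewrite scalerBr scalerAr scalerAl.
Qed.

Lemma cubic_relE i :
  \sum_a \sum_b \sum_c (G a b * G c i - G a i * G b c) *: (S a * S b * S c) =
  \sum_l G l i *: rel l.
Proof.
rewrite -up_quad.
have -> : quad * up i = \sum_a \sum_b \sum_c (G a b * G c i) *: (S a * S b * S c).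
  rewrite mulr_suml [RHS]exchange_big /=; apply: eq_bigr => b _.
  rewrite !mulr_suml; apply: eq_bigr => a _ /=.
  rewrite mulr_sumr; apply: eq_bigr => c _.
  by rewrite -!scalerAl -scalerAr scalerA.
have -> : up i * quad = \sum_a \sum_b \sum_c (G a i * G b c) *: (S a * S b * S c).
  rewrite mulr_suml; apply: eq_bigr => a _; rewrite [RHS]exchange_big /= mulr_sumr.
  apply: eq_bigr => c _; rewrite mulr_suml mulr_sumr; apply: eq_bigr => b _.
  by rewrite -!scalerAl -scalerAr scalerA mulrA.
rewrite -sumrB; apply: eq_bigr => a _; rewrite -sumrB; apply: eq_bigr => b _.
by rewrite -sumrB; apply: eq_bigr => c _; rewrite scalerBl.
Qed.

Lemma up_hom i : up i \in hom 1.
Proof. by apply: rpred_sum => l _; rewrite rpredZ. Qed.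

Lemma quad_hom : quad \in hom 2.
Proof. by apply: rpred_sum => i _; apply: (homM (up_hom i)). Qed.

Lemma rel_hom i : rel i \in hom 3.
Proof. by apply: submodB; [exact: homM quad_hom (S_hom i) | exact: homM (S_hom i) quad_hom]. Qed.

Local Notation levQ := (level S hom (fun _ : 'I_1 => quad)).
Local Notation levW := (level S hom rel).

Lemma levQP k x : x \in levQ k.+1 -> exists (u : 'I_n -> A) (c : A),
  [/\ forall i, u i \in levQ k, c \in hom k & x = \sum_i u i * S i + c * quad].
Proof.
move=> /levelP[u [v [uk vk ->]]]; exists u, (v ord0); split=> //.
by rewrite big_ord1.
Qed.

Lemma levQ_quad k c : c \in hom k -> c * quad \in levQ k.+1.
Proof. exact: (@level_mulp _ _ _ _ _ _ (fun _ : 'I_1 => quad) k c ord0). Qed.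

Lemma lev_mulup m (p : 'I_m -> A) k x i :
  x \in level S hom p k.-1 -> x * up i \in level S hom p k.
Proof.
move=> xk; rewrite mulr_sumr rpred_sum // => l _.
by rewrite -scalerAr rpredZ ?level_pred_mulS.
Qed.

Hypothesis n_gt1 : (1 < n)%N.

Lemma orthogonal_neq0 (a : 'I_n -> K) :
  exists b : 'I_n -> K, \sum_i a i * b i = 0 /\ exists i, b i != 0.
Proof.
pose i0 := Ordinal (ltnW n_gt1); pose i1 := Ordinal n_gt1.
have [a0|a0] := eqVneq (a i0) 0.
  exists (fun i => (i == i0)%:R); split; last by exists i0; rewrite eqxx oner_eq0.
  rewrite (bigD1 i0) //= a0 mul0r big1 ?addr0 // => i /negPf->.
  by rewrite mulr0.
exists (fun i => if i == i0 then - a i1 else if i == i1 then a i0 else 0).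
split; last by exists i1.
rewrite (bigD1 i0) //= (bigD1 i1) //= big1 ?addr0.
  by rewrite mulrN mulrC addNr.
by move=> i /andP[/negPf-> /negPf->]; rewrite mulr0.
Qed.

(* Comparing last letters gives a i *: b = c * up i modulo the ideal of quad;
   a nonzero vector orthogonal to a then yields the same situation for c, one
   degree lower. *)
Lemma levQ_cancel d b (a : 'I_n -> K) i0 :
  b \in hom d -> a i0 != 0 -> b * (\sum_i a i *: S i) \in levQ d ->
  b \in levQ d.-1.
Proof.
elim: d b a i0 => [|d IH] b a i0 bd ai0.
  move=> /level0 /(congr1 (D i0)); rewrite raddf0 mulr_sumr.
  under eq_bigr => i _ do rewrite -scalerAr scalerAl.
  rewrite D_sumS => /eqP; rewrite scaler_eq0 (negPf ai0) => /eqP->.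
  exact: rpred0.
move=> /levQP[u [c [ud cd bE]]] /=.
have baE i : a i *: b = u i + c * up i.
  have /(congr1 (D i)) := bE; rewrite raddfD /= D_sumS D_quad mulr_sumr.
  by under eq_bigr => j _ do rewrite -scalerAr scalerAl; rewrite D_sumS.
have [be [abe [i1 bei1]]] := orthogonal_neq0 a.
pose ga (l : 'I_n) := \sum_i be i * G l i.
have [l gal] : exists l, ga l != 0.
  apply/existsP; apply: contra_neqT bei1; rewrite negb_exists => /forallP ga0.
  have : \row_i be i *m G = 0.
    apply/rowP => l; rewrite !mxE -[RHS](eqP (negPn (ga0 l))).
    by apply: eq_bigr => i _; rewrite !mxE G_symE.
  move/(congr1 (mulmx^~ (invmx G))); rewrite mulmxK // mul0mx => /rowP/(_ i1).
  by rewrite !mxE.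
have /(IH _ _ _ cd gal) cd1 : c * (\sum_l ga l *: S l) \in levQ d.
  have -> : c * (\sum_l ga l *: S l) = - \sum_i be i *: u i.
    apply/eqP; rewrite -subr_eq0 opprK addrC; apply/eqP.
    transitivity (\sum_i be i *: (u i + c * up i)).
      under [RHS]eq_bigr => i _ do rewrite scalerDr.
      rewrite big_split /=; congr (_ + _).
      under [RHS]eq_bigr => i _ do rewrite scalerAr.
      rewrite -mulr_sumr; congr (_ * _).
      under [RHS]eq_bigr => i _ do rewrite scaler_sumr.
      rewrite exchange_big; apply: eq_bigr => j _ /=; rewrite scaler_suml.
      by apply: eq_bigr => i _; rewrite scalerA.
    under eq_bigr => i _ do rewrite -baE scalerA mulrC.
    by rewrite -scaler_suml abe scale0r.
  by apply/submodN/rpred_sum => i _; rewrite rpredZ.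
rewrite -[b]scale1r -(mulVf ai0) -scalerA baE rpredZ ?rpredD ?lev_mulup //.
Qed.

Lemma levQ_cancel_up d b :
  b \in hom d -> (forall i, b * up i \in levQ d) -> b \in levQ d.-1.
Proof.
move=> bd bup; pose i0 := Ordinal (ltnW n_gt1).
apply: (@levQ_cancel _ _ (fun i => (i == i0)%:R) i0) => //; first by rewrite eqxx oner_eq0.
have -> : \sum_i (i == i0)%:R *: S i = \sum_i invmx G i i0 *: up i.
  rewrite mulmx1_comb ?mulmxV // (bigD1 i0) //= scale1r big1 ?addr0 //.
  by move=> i /negPf->; rewrite scale0r.
rewrite mulr_sumr rpred_sum // => i _.
by rewrite -scalerAr rpredZ.
Qed.

Lemma levW_levQ k x : x \in levW k -> x \in levQ k.+1.
Proof.
elim: k x => [x /level0->|k IH x /levelP[u [v [uk vk ->]]]]; first exact: rpred0.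
apply: rpredD; first by apply: level_sumS => i; exact: IH.
apply: rpred_sum => i _; rewrite mulrBr submodB // mulrA.
  by rewrite level_mulS // levQ_quad.
by apply: levQ_quad; rewrite -addn1 homM.
Qed.

Lemma levQ_split k x : x \in levQ k.+1 ->
  exists2 c, c \in hom k & x - c * quad \in levW k.
Proof.
elim: k x => [|k IH] x /levQP[u [c [uk ck ->]]].
  exists c => //; rewrite addrK rpred_sum // => i _.
  by rewrite (level0 (uk i)) mul0r rpred0.
have /choice[e eP] i : exists e, e \in hom k /\ u i - e * quad \in levW k.
  by have [e] := IH _ (uk i); exists e.
exists (c + \sum_i e i * S i).
  by rewrite rpredD // rpred_sum // => i _; rewrite -addn1 homM // (eP i).1.
apply/levelP; exists (fun i => u i - e i * quad), e.
split=> [i|i|]; [exact: (eP i).2 | exact: (eP i).1 |].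
rewrite mulrDl mulr_suml opprD addrA addrK -sumrB -big_split /=.
apply: eq_bigr => i _.
by rewrite mulrBl mulrBr !mulrA addrA subrK.
Qed.

Lemma levW_rel_up d h i : h \in hom d ->
  h * (quad * up i - up i * quad) \in levW d.+1.
Proof.
move=> hd; rewrite up_quad mulr_sumr rpred_sum // => l _.
by rewrite -scalerAr rpredZ // level_mulp.
Qed.

Definition quad_regular d :=
  forall a, a \in hom d -> a * quad \in levW d -> a \in levW d.-2.

(* The conclusion d == 0 -> e = 0 accounts for d.-1 being truncated. *)
Lemma koszul_step d (v : 'I_n -> A) c :
  quad_regular d -> (forall i, v i \in hom d) -> c \in hom d.+1 ->
  (forall i, v i * quad - c * up i \in levW d) ->
  exists e, [/\ (d == 0%N -> e = 0), e \in hom d.-1,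
    c - e * quad \in levW d.-1 & forall i, v i - e * up i \in levW d.-2].
Proof.
move=> reg vd cd vc.
have /(levQ_cancel_up cd) : forall i, c * up i \in levQ d.+1.
  move=> i; rewrite -[c * _](subKr (v i * quad)) submodB ?levQ_quad //.
  exact: levW_levQ.
case: d reg vd cd vc => [|d] reg vd cd vc.
  move=> /level0 c0; exists 0; rewrite c0 mul0r subr0; split=> // [||i].
  - exact: rpred0.
  - exact: rpred0.
  by rewrite mul0r subr0 reg //; have := vc i; rewrite c0 mul0r subr0.
move=> /levQ_split[e ed ceW]; exists e; split=> // i.
apply: reg; first by rewrite submodB // -addn1 homM // up_hom.
have -> : (v i - e * up i) * quad = (v i * quad - c * up i)
    + (c - e * quad) * up i + e * (quad * up i - up i * quad).
  by rewrite mulrBl mulrBl mulrBr !mulrA !addrA subrK subrK.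
by apply: rpredD; [apply: rpredD; [exact: vc | exact: lev_mulup] | exact: levW_rel_up].
Qed.

Lemma quad_regularP d : quad_regular d.
Proof.
elim: d => [|d IH] a ad.
  move=> /level0 aq.
  suff -> : a = 0 by exact: rpred0.
  have aup i : a * up i = 0 by rewrite -D_quad aq raddf0.
  apply/level0/(levQ_cancel_up ad) => i; rewrite aup; exact: rpred0.
move=> /levelP[u [v [ud vd aqE]]].
set c := \sum_i v i * S i.
have cd : c \in hom d.+1 by rewrite rpred_sum // => i _; rewrite -addn1 homM.
have acW i : v i * quad - (a + c) * up i \in levW d.
  have /(congr1 (D i)) := aqE; rewrite raddfD /= D_quad D_sumS D_rel -/c => aup.
  by rewrite mulrDl aup addrA subrK opprD addrCA subrr addr0 submodN.
have [e [_ _ aceW veW]] := koszul_step IH vd (rpredD ad cd) acW.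
have -> : a = a + c - e * quad - \sum_i (v i - e * up i) * S i.
  under eq_bigr => i _ do rewrite mulrBl -mulrA.
  by rewrite sumrB -mulr_sumr opprB addrA subrK addrK.
by rewrite submodB // rpred_sum // => i _; rewrite level_pred_mulS.
Qed.

Lemma koszul_exact d (v : 'I_n -> A) : (forall i, v i \in hom d) ->
  (forall i, v i * quad - (\sum_j v j * S j) * up i \in levW d) ->
  exists e, [/\ (d == 0%N -> e = 0), e \in hom d.-1 &
     forall i, v i - e * up i \in levW d.-2].
Proof.
move=> vd vc; have cd : \sum_j v j * S j \in hom d.+1.
  by rewrite rpred_sum // => i _; rewrite -addn1 homM.
have [e [e0 ed _ ev]] := koszul_step (@quad_regularP d) vd cd vc.
by exists e.
Qed.

Variables (fil : nat -> submodClosed A) (top : nat -> {additive A -> A}).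
Hypothesis filM : forall d e x y, x \in fil d -> y \in fil e -> x * y \in fil (d + e)%N.
Hypothesis filS : forall d, {subset fil d <= fil d.+1}.
Hypothesis hom_fil : forall d, {subset hom d <= fil d}.
Hypothesis D_fil : forall d i x, x \in fil d.+1 -> D i x \in fil d.
Hypothesis fil0 : forall x, x \in fil 0 -> exists k : K, x = k%:A.
Hypothesis fil_split : forall d x, x \in fil d.+1 ->
  exists2 y, y \in fil 0 & x = y + \sum_i D i x * S i.
Hypothesis top_hom : forall d x, top d x \in hom d.
Hypothesis topM : forall d e x y, y \in hom e -> top (d + e) (x * y) = top d x * y.
Hypothesis top_fil : forall d x, x \in fil d -> top d.+1 x = 0.
Hypothesis fil_top : forall d x, x \in fil d.+1 -> x - top d.+1 x \in fil d.
Hypothesis fil0_top : forall x, x \in fil 0 -> top 0 x = x.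

Variable phi : 'I_n -> A.
Hypothesis phi_fil : forall i, phi i \in fil 2.

Definition defrel (i : 'I_n) : A := rel i - phi i.

Lemma phi_overlap : \sum_i (phi i * up i + up i * phi i) =
  - \sum_i (defrel i * up i + up i * defrel i).
Proof.
apply/eqP; rewrite -subr_eq0 opprK -big_split /= -[X in _ == X]rel_overlap.
apply/eqP/eq_bigr => i _; rewrite addrACA -mulrDl -mulrDr.
by rewrite addrC [_ + defrel i]addrC subrK addrC.
Qed.

Hypothesis overlap_resolved : exists c : 'I_n -> K,
  \sum_i (phi i * up i + up i * phi i) = \sum_i c i *: defrel i.

Local Notation levP := (level S fil defrel).

Lemma fil_le d e : (d <= e)%N -> {subset fil d <= fil e}.
Proof.
move=> /subnK<-; elim: (e - d)%N => [|i IH] x xd //.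
by rewrite addSn; apply/filS/IH.
Qed.

Lemma fil_sumS d (u : 'I_n -> A) :
  (forall i, u i \in fil d) -> \sum_i u i * S i \in fil d.+1.
Proof.
move=> ud; apply: rpred_sum => i _; rewrite -addn1 filM //.
exact/hom_fil/S_hom.
Qed.

Lemma levP_fil k : {subset levP k <= fil k.+2}.
Proof.
elim: k => [|k IH] x; first by move/level0->; exact: rpred0.
move=> /levelP[u [v [uk vk ->]]]; apply: rpredD.
  by apply: fil_sumS => i; exact: IH.
apply: rpred_sum => i _; rewrite -addn3 filM //.
by apply: submodB; [exact/hom_fil/rel_hom | exact/filS/phi_fil].
Qed.

Lemma levP_mulr k d x a : x \in levP k -> a \in fil d -> x * a \in levP (k + d).
Proof.
move=> xk; elim: d a => [|d IH] a ad.
  by have [c ->] := fil0 ad; rewrite -scalerAr mulr1 addn0 rpredZ.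
have [y /fil0[c ->] ->] := fil_split ad; rewrite mulrDr -scalerAr mulr1 mulr_sumr.
rewrite rpredD ?rpredZ //; first exact: (level_le filS (leq_addr _ _)).
under eq_bigr => i _ do rewrite mulrA.
by rewrite addnS; apply: level_sumS => i; apply/IH/D_fil.
Qed.

Lemma top_defrel k (u v : 'I_n -> A) : (forall i, v i \in fil k) ->
  top k.+3 (\sum_i u i * S i + \sum_i v i * defrel i) =
  \sum_i top k.+2 (u i) * S i + \sum_i top k (v i) * rel i.
Proof.
move=> vk; rewrite raddfD !raddf_sum; congr (_ + _); apply: eq_bigr => i _ /=.
  by rewrite -addn1 topM.
rewrite mulrBr raddfB /= [X in _ - X]top_fil ?subr0; last first.
  by rewrite -addn2 filM.
by rewrite -addn3 topM // rel_hom.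
Qed.

Lemma levP_top k x : x \in levP k -> top k.+2 x \in levW k.
Proof.
elim: k x => [|k IH] x; first by move/level0->; rewrite raddf0 rpred0.
move=> /levelP[u [v [uk vk ->]]]; rewrite top_defrel //; apply/levelP.
by exists (fun i => top k.+2 (u i)), (fun i => top k (v i)); split=> // i; exact: IH.
Qed.

Lemma levW_lift k x : x \in levW k -> exists2 y, y \in levP k & x - y \in fil k.+1.
Proof.
elim: k x => [|k IH] x; first by move/level0->; exists 0; rewrite ?subr0 rpred0.
move=> /levelP[u [v [uk vk ->]]].
have /choice[y yP] i : exists y, y \in levP k /\ u i - y \in fil k.+1.
  by have [y] := IH _ (uk i); exists y.
exists (\sum_i y i * S i + \sum_i v i * defrel i).
  apply/levelP; exists y, v; split=> // i; [exact: (yP i).1 | exact/hom_fil/vk].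
rewrite opprD addrACA -!sumrB rpredD //.
  under eq_bigr => i _ do rewrite -mulrBl.
  by apply: fil_sumS => i; exact: (yP i).2.
apply: rpred_sum => i _; rewrite -mulrBr subKr -addn2 filM //.
exact/hom_fil/vk.
Qed.

Lemma levP_mul_defrel k x r : x \in levP k ->
  exists (u : 'I_n -> A) y, [/\ forall i, u i \in levP k.+2, y \in levP k.+2 &
    x * defrel r = \sum_i u i * S i + y].
Proof.
move=> xk.
exists (fun i => (if i == r then x * quad else 0) - x * S r * up i), (- (x * phi r)).
split=> [i||].
- apply: submodB; last by rewrite -mulrA -addn2 levP_mulr // hom_fil // (homM (S_hom r)) // up_hom.
  by case: eqP => _; rewrite ?rpred0 // -addn2 levP_mulr // hom_fil // quad_hom.
- by apply: submodN; rewrite -addn2 levP_mulr.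
under eq_bigr => i _ do rewrite mulrBl -[x * S r * up i * S i]mulrA.
rewrite sumrB -mulr_sumr -/quad (bigD1 r) //= eqxx big1 ?addr0.
  by rewrite !mulrBr !mulrA.
by move=> i /negPf->; rewrite mul0r.
Qed.

Lemma levP_overlap d e : e \in fil d ->
  exists (u : 'I_n -> A) y, [/\ forall i, u i \in levP d.+1, y \in levP d.+1 &
    \sum_i e * up i * defrel i = \sum_i u i * S i + y].
Proof.
move=> ed; have [c cE] := overlap_resolved.
exists (fun i => - \sum_l G i l *: (e * defrel l)), (- (e * \sum_i c i *: defrel i)).
have eP l : e * defrel l \in levP d.+1 by exact: level_mulp.
split=> [i||].
- by apply: submodN; apply: rpred_sum => l _; rewrite rpredZ.
- apply: submodN; rewrite mulr_sumr; apply: rpred_sum => i _.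
  by rewrite -scalerAr rpredZ.
rewrite -cE; under eq_bigr => i _ do rewrite -mulrA.
rewrite -mulr_sumr.
have -> : \sum_i (- \sum_l G i l *: (e * defrel l)) * S i = - (e * \sum_i defrel i * up i).
  under eq_bigr => i _ do rewrite mulNr mulr_suml.
  rewrite sumrN exchange_big /= mulr_sumr; congr (- _); apply: eq_bigr => l _.
  rewrite !mulr_sumr; apply: eq_bigr => i _.
  by rewrite -scalerAl -!scalerAr mulrA.
rewrite -opprD -mulrDr -mulrN; congr (_ * _).
by rewrite phi_overlap opprD opprK big_split addKr.
Qed.

Lemma levW_lift_pred k x :
  x \in levW k.-1 -> exists2 y, y \in levP k.-1 & x - y \in fil k.
Proof.
case: k => [|k]; last exact: levW_lift.
by move/level0->; exists 0; rewrite ?subr0 rpred0.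
Qed.

Lemma levP_pred_mul_defrel k x r : x \in levP k.-1 ->
  exists (u : 'I_n -> A) y, [/\ forall i, u i \in levP k.+1, y \in levP k.+1 &
    x * defrel r = \sum_i u i * S i + y].
Proof.
case: k => [/level0->|k]; last exact: levP_mul_defrel.
exists (fun=> 0), 0; split=> [i||]; rewrite ?rpred0 // mul0r addr0 big1 // => i _.
by rewrite mul0r.
Qed.

Lemma levP_normalize k x : x \in levP k.+1 -> x \in fil k.+2 ->
  exists (u : 'I_n -> A) y, [/\ forall i, u i \in levP k, y \in levP k &
    x = \sum_i u i * S i + y].
Proof.
move=> /levelP[u [v [uk vk xE]]] /top_fil xtop.
have topE := top_defrel u vk; rewrite -xE in topE.
have vW i : top k (v i) * quad - (\sum_j top k (v j) * S j) * up i \in levW k.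
  have /(congr1 (D i)) := topE; rewrite xtop raddf0 raddfD /= D_sumS D_rel.
  by move/esym/eqP; rewrite addrC addr_eq0 => /eqP->; apply/submodN/levP_top.
have [e [e0 ek eW]] := koszul_exact (fun i => top_hom k (v i)) vW.
case: k => [|k] in u v uk vk xE xtop topE vW e0 ek eW *.
  exists u, 0; split; rewrite ?rpred0 // xE; congr (_ + _); rewrite big1 // => i _.
  have /level0 := eW i; rewrite e0 // mul0r subr0 fil0_top // => ->.
  by rewrite mul0r.
have /choice[w wP] i : exists w, w \in levP k.-1 /\
    top k.+1 (v i) - e * up i - w \in fil k.
  by have [w] := levW_lift_pred (eW i); exists w.
have [u1 [y1 [u1k y1k E1]]] := levP_overlap (hom_fil ek).
have /choice[u2 /choice[y2 P2]] i := levP_pred_mul_defrel i (wP i).1.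
exists (fun i => u i + u1 i + \sum_j u2 j i),
  (y1 + \sum_i y2 i + \sum_i (v i - e * up i - w i) * defrel i).
split=> [i||].
- rewrite !rpredD // rpred_sum // => j _; by have [] := P2 j.
- rewrite !rpredD ?rpred_sum // => i _; first by have [] := P2 i.
  apply: level_mulp.
  have -> : v i - e * up i - w i =
      (v i - top k.+1 (v i)) + (top k.+1 (v i) - e * up i - w i).
    by rewrite !addrA subrK.
  by apply: rpredD; [exact: (fil_top (vk i)) | exact: (wP i).2].
have -> : \sum_i (u i + u1 i + \sum_j u2 j i) * S i =
    \sum_i u i * S i + \sum_i u1 i * S i + \sum_j \sum_i u2 j i * S i.
  rewrite [X in _ = _ + X]exchange_big -!big_split /=; apply: eq_bigr => i _.
  by rewrite !mulrDl mulr_suml.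
have vE : \sum_i v i * defrel i = \sum_i e * up i * defrel i
    + \sum_i w i * defrel i + \sum_i (v i - e * up i - w i) * defrel i.
  rewrite -!big_split /=; apply: eq_bigr => i _.
  by rewrite -!mulrDl -[v i - _ - _]addrA -opprD [X in _ = X * _]addrC subrK.
have wE : \sum_i w i * defrel i = \sum_j \sum_i u2 j i * S i + \sum_i y2 i.
  by rewrite -big_split /=; apply: eq_bigr => i _; have [] := P2 i.
by rewrite xE vE E1 wE [X in _ + (X + _)]addrACA !addrA.
Qed.

Lemma levP_reduce k x : x \in levP k.+1 -> x \in fil k.+2 -> x \in levP k.
Proof.
elim: k x => [|k IH] x xk xf; have [u [y [uk yk xE]]] := levP_normalize xk xf.
  rewrite xE rpredD // big1 ?rpred0 // => i _.
  by rewrite (level0 (uk i)) mul0r.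
rewrite xE rpredD // level_sumS // => i; apply: IH => //.
rewrite -(D_sumS i u); apply: D_fil.
by rewrite -[X in X \in _](addrK y) -xE submodB // (levP_fil yk).
Qed.


Hypothesis top_id : forall d x, x \in hom d -> top d x = x.
Hypothesis reducible : forall k x, x \in levP k.+1 -> x \in fil k.+2 -> x \in levP k.

Lemma levP_fil_level k d x : x \in levP k -> x \in fil d -> x \in levP d.-2.
Proof.
elim: k => [|k IH] xk xd; first exact: level_le xk.
have [dk|] := leqP d.-2 k; last by move/(level_le filS); apply.
apply: IH => //; apply: reducible => //; apply: fil_le xd.
by case: d dk => [|[|d]].
Qed.

Lemma levP_leading k d x y : x \in hom d ->
  (if d is e.+1 then y \in fil e else y == 0) -> x - y \in levP k ->
  x \in levW d.-2.
Proof.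
move=> xd yd xyk.
have /levP_fil_level : x - y \in levP k by [].
case: d xd yd => [|d] xd yd.
  move=> /(_ 0%N); rewrite (eqP yd) subr0; apply; exact: hom_fil.
have xyd : x - y \in fil d.+1 by apply: submodB; [exact: hom_fil | exact: filS].
move=> /(_ _ xyd); rewrite -{2}(top_id xd) -[top _ x]subr0 -(top_fil yd) -raddfB.
by case: d {xd yd xyd} => [/level0->|d /levP_top //]; rewrite raddf0 rpred0.
Qed.

End Cubic.

Section LowDegree.
Variables (K : fieldType) (n : nat) (A : algType K) (S : 'I_n -> A).
Variable D : 'I_n -> {linear A -> A}.
Hypothesis D_mulS : forall i x j, D i (x * S j) = if j == i then x else 0.
Hypothesis D1 : forall i, D i 1 = 0.

Definition low (a3 : 'I_n -> 'I_n -> 'I_n -> K) (a2 : 'I_n -> 'I_n -> K)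
    (a1 : 'I_n -> K) (a0 : K) : A :=
  \sum_a \sum_b \sum_c a3 a b c *: (S a * S b * S c)
  + \sum_a \sum_b a2 a b *: (S a * S b) + \sum_a a1 a *: S a + a0 *: 1.

Lemma low_ext a3 a2 a1 a0 b3 b2 b1 b0 :
  (forall a b c, a3 a b c = b3 a b c) -> (forall a b, a2 a b = b2 a b) ->
  (forall a, a1 a = b1 a) -> a0 = b0 -> low a3 a2 a1 a0 = low b3 b2 b1 b0.
Proof.
move=> E3 E2 E1 ->; congr (_ + _ + _ + _); apply: eq_bigr => a _; last by rewrite E1.
  by apply: eq_bigr => b _; apply: eq_bigr => c _; rewrite E3.
by apply: eq_bigr => b _; rewrite E2.
Qed.

Lemma last_letter_eq (u v : 'I_n -> A) (k l : K) :
  \sum_i u i * S i + k%:A = \sum_i v i * S i + l%:A -> u =1 v /\ k = l.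
Proof.
move=> uv; have E i : u i = v i.
  have /(congr1 (D i)) := uv.
  by rewrite !raddfD /= !linearZ /= D1 !scaler0 !addr0 !(D_sumS D_mulS).
split=> //; move: uv; rewrite (eq_bigr (fun i => v i * S i)) => [|i _]; last by rewrite E.
move/addrI/eqP; rewrite -subr_eq0 -scalerBl scaler_eq0 oner_eq0 orbF subr_eq0.
by move/eqP.
Qed.

Lemma lowE a3 a2 a1 a0 : low a3 a2 a1 a0 =
  \sum_c (\sum_b (\sum_a (a3 a b c)%:A * S a + (a2 b c)%:A) * S b + (a1 c)%:A) * S c
  + a0%:A.
Proof.
rewrite /low; congr (_ + _).
under [RHS]eq_bigr => c _ do rewrite mulrDl -scalerAl mul1r mulr_suml.
rewrite big_split /=; congr (_ + _).
have -> : \sum_a \sum_b \sum_c a3 a b c *: (S a * S b * S c) =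
    \sum_c \sum_b \sum_a a3 a b c *: (S a * S b * S c).
  under eq_bigr => a _ do rewrite exchange_big /=.
  by rewrite exchange_big; apply: eq_bigr => c _; rewrite exchange_big.
rewrite [X in _ + X]exchange_big -big_split /=; apply: eq_bigr => c _.
rewrite -big_split /=; apply: eq_bigr => b _.
rewrite !mulrDl -!scalerAl mul1r; congr (_ + _).
rewrite !mulr_suml; apply: eq_bigr => a _.
by rewrite -!scalerAl mul1r.
Qed.

Lemma low_eq a3 a2 a1 a0 b3 b2 b1 b0 : low a3 a2 a1 a0 = low b3 b2 b1 b0 ->
  [/\ forall a b c, a3 a b c = b3 a b c, forall a b, a2 a b = b2 a b,
      forall a, a1 a = b1 a & a0 = b0].
Proof.
rewrite !lowE => /last_letter_eq[E1 E0].
have E2 c := last_letter_eq (E1 c).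
have E3 c b := last_letter_eq ((E2 c).1 b).
split=> // [a b c|a b|a]; [|exact: (E3 b a).2 | exact: (E2 a).2].
have /eqP := (E3 c b).1 a; rewrite -subr_eq0 -scalerBl scaler_eq0 oner_eq0 orbF.
by rewrite subr_eq0 => /eqP.
Qed.

Lemma low_sum_relB (G : 'M[K]_n) (j2 : 'I_n -> 'I_n -> 'I_n -> K)
    (j1 : 'I_n -> 'I_n -> K) (j0 c : 'I_n -> K) :
  \sum_r c r *: (\sum_l G l r *: rel S G l
    - (\sum_a \sum_b j2 a b r *: (S a * S b) + \sum_a j1 a r *: S a + j0 r *: 1)) =
  low (fun a b d => \sum_r c r * (G a b * G d r - G a r * G b d))
      (fun a b => - \sum_r c r * j2 a b r) (fun a => - \sum_r c r * j1 a r)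
      (- \sum_r c r * j0 r).
Proof.
have pull I (f : I -> 'I_n -> K) (x : I -> A) (s : seq I) :
    \sum_r c r *: \sum_(i <- s) f i r *: x i =
    \sum_(i <- s) (\sum_r c r * f i r) *: x i.
  under eq_bigr => r _ do rewrite scaler_sumr.
  rewrite exchange_big; apply: eq_bigr => i _ /=; rewrite scaler_suml.
  by apply: eq_bigr => r _; rewrite scalerA.
under eq_bigr => r _ do rewrite -cubic_relE scalerBr !scalerDr.
rewrite sumrB !big_split /= !opprD !addrA.
congr (_ + _ + _ + _).
- under eq_bigr => r _ do rewrite scaler_sumr.
  rewrite exchange_big; apply: eq_bigr => a _ /=.
  under eq_bigr => r _ do rewrite scaler_sumr.
  by rewrite exchange_big; apply: eq_bigr => b _; exact: pull.
- under eq_bigr => r _ do rewrite scaler_sumr.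
  rewrite exchange_big -sumrN; apply: eq_bigr => a _ /=.
  rewrite pull -sumrN; apply: eq_bigr => b _; by rewrite scaleNr.
- by rewrite pull -sumrN; apply: eq_bigr => a _; rewrite scaleNr.
rewrite scaleNr scaler_suml; congr (- _); apply: eq_bigr => r _.
by rewrite scalerA.
Qed.

Lemma low_overlap (j2 : 'I_n -> 'I_n -> 'I_n -> K)
    (j1 : 'I_n -> 'I_n -> K) (j0 : 'I_n -> K)
    (f := fun r => \sum_a \sum_b j2 a b r *: (S a * S b)
                   + \sum_a j1 a r *: S a + j0 r *: 1) :
  \sum_r (f r * S r + S r * f r) =
  low (fun a b c => j2 a b c + j2 b c a) (fun a b => j1 a b + j1 b a)
      (fun a => j0 a *+ 2) 0.
Proof.
have fS : \sum_r f r * S r = low j2 j1 j0 0.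
  rewrite lowE scale0r addr0; apply: eq_bigr => r _; congr (_ * _).
  rewrite /f; congr (_ + _); rewrite exchange_big -big_split /=.
  apply: eq_bigr => b _; rewrite mulrDl mulr_suml -scalerAl mul1r; congr (_ + _).
  by apply: eq_bigr => a _; rewrite -!scalerAl mul1r.
have Sf : \sum_r S r * f r =
    low (fun a b c => j2 b c a) (fun a b => j1 b a) j0 0.
  rewrite /low scale0r addr0 -!big_split /=; apply: eq_bigr => a _.
  rewrite /f !mulrDr !mulr_sumr -scalerAr mulr1; congr (_ + _ + _).
    apply: eq_bigr => b _; rewrite mulr_sumr; apply: eq_bigr => c _.
    by rewrite -scalerAr mulrA.
  by apply: eq_bigr => b _; rewrite -scalerAr.
rewrite big_split /= fS Sf /low !scale0r !addr0 addrACA [X in X + _ = _]addrACA.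
congr (_ + _ + _); rewrite -big_split /=; apply: eq_bigr => a _.
- rewrite -big_split /=; apply: eq_bigr => b _.
  by rewrite -big_split; apply: eq_bigr => c _; rewrite scalerDl.
- by rewrite -big_split; apply: eq_bigr => b _; rewrite scalerDl.
by rewrite mulr2n scalerDl.
Qed.

Lemma overlap_lower (g G : 'M[K]_n) (f : 'I_n -> A) :
  (forall r, \sum_i g r i *: up S G i = S r) ->
  \sum_i ((\sum_r g r i *: f r) * up S G i + up S G i * (\sum_r g r i *: f r)) =
  \sum_r (f r * S r + S r * f r).
Proof.
move=> gup; rewrite !big_split /=; congr (_ + _).
  under eq_bigr => i _ do rewrite mulr_suml.
  rewrite exchange_big; apply: eq_bigr => r _ /=.
  rewrite -[in RHS]gup mulr_sumr; apply: eq_bigr => i _.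
  by rewrite -scalerAl scalerAr.
under eq_bigr => i _ do rewrite mulr_sumr.
rewrite exchange_big; apply: eq_bigr => r _ /=.
rewrite -[in RHS]gup mulr_suml; apply: eq_bigr => i _.
by rewrite -scalerAr scalerAl.
Qed.

End LowDegree.

Section TensorAlgebra.
Variables (K : fieldType) (n : nat).
Local Notation T := (tens K n).

Fact tens_scalarAr (k : K) (x y : T) : k *: (x * y) = x * (k *: y).
Proof. by rewrite -!tens_scE !mulrA sc_comm. Qed.
HB.instance Definition _ := GRing.Lalgebra_isAlgebra.Build K T tens_scalarAr.

Lemma mcoeff_mulgen_nil (x : T) i : (x * gen K i)@_[::] = 0.
Proof.
rewrite [LHS](@mcoeffMl (word n) K) big1 // => v _; rewrite big1_seq // => w /= _.
rewrite mcoeffU; case: ([:: i] =P w) => [<-|_]; last by rewrite mulr0 mul0rn.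
by case: v.
Qed.

Lemma mcoeff_mulgen_rcons (x : T) i w j :
  (x * gen K i)@_(rcons w j) = x@_w *+ (i == j).
Proof.
have -> : x * gen K i = \sum_(v <- msupp x) << x@_v *g rcons v i : word n >>.
  by rewrite malgM_def fgmulgU; apply: eq_bigr => v _; rewrite mulr1 /= -cats1.
rewrite raddf_sum /= (eq_bigr (fun v => x@_v *+ (i == j) *+ (v == w))).
  rewrite [in RHS](monalgE x) raddf_sum -sumrMnl /=.
  by apply: eq_bigr => v _; rewrite mcoeffU mulrnAC.
by move=> v _; rewrite mcoeffU eqseq_rcons; case: (v == w); case: (i == j).
Qed.

(* The unique x_i such that x = c + sum_i x_i * gen i. *)
Definition rder (i : 'I_n) (x : T) : T :=
  [malg w in [fset (take (size v).-1 v : word n) | v in msupp x]%fset =>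
     x@_(rcons w i)].

Lemma rderE i x w : (rder i x)@_w = x@_(rcons w i).
Proof.
rewrite mcoeffE; case: ifPn => // wx; apply/esym/mcoeff_outdom/negP => xw.
case/negP: wx; apply/imfsetP; exists (rcons w i) => //.
by rewrite size_rcons /= -cats1 take_size_cat.
Qed.

Fact rder_linear i : linear (rder i).
Proof. by move=> k x y; apply/malgP => w; rewrite !(mcoeffD, mcoeffZ, rderE). Qed.
HB.instance Definition _ i := GRing.isLinear.Build K T T *:%R (rder i) (rder_linear i).

Lemma rder_mulgen i x j : rder i (x * gen K j) = if j == i then x else 0.
Proof.
apply/malgP => w; rewrite rderE mcoeff_mulgen_rcons.
by case: eqP; rewrite ?mulr1n // mulr0n mcoeff0.
Qed.

Lemma rder1 i : rder i 1 = 0.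
Proof.
apply/malgP => w; rewrite rderE -(rmorph1 (@sc K T)) mcoeff_sc mcoeff0.
by case: eqP => // /(congr1 size); rewrite size_rcons.
Qed.

Lemma rder_split x : x = sc x@_[::] + \sum_i rder i x * gen K i.
Proof.
apply/malgP => w; case/lastP: w => [|w j]; rewrite mcoeffD mcoeff_sc raddf_sum /=.
  by rewrite mulr1n big1 ?addr0 // => i _; exact: mcoeff_mulgen_nil.
rewrite -size_eq0 size_rcons add0r.
rewrite (eq_bigr (fun i => x@_(rcons w i) *+ (i == j))) => [|i _]; last first.
  by rewrite mcoeff_mulgen_rcons rderE.
rewrite (bigD1 j) //= eqxx big1 ?addr0 // => i /negPf ij.
by rewrite ij.
Qed.

Lemma rder_fil d i x : x \in tens_fil d.+1 -> rder i x \in tens_fil d.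
Proof.
by move=> /tens_filP xd; apply/tens_filP => w wd; rewrite rderE xd // size_rcons.
Qed.

Lemma fil0E (x : T) : x \in tens_fil 0 -> x = sc x@_[::].
Proof.
move=> /tens_filP x0; apply/malgP => w; rewrite mcoeff_sc.
by case: eqP => [->|]; [rewrite mulr1n | move=> w0; rewrite (x0 w) ?mulr0n // ltnNge leqn0 size_eq0; exact/eqP].
Qed.

Lemma tens_fil_le d e : (d <= e)%N -> {subset @tens_fil K n d <= tens_fil e}.
Proof.
move=> de x /tens_filP xd; apply/tens_filP => w ew; apply: xd.
exact: leq_ltn_trans de ew.
Qed.

Lemma fil_exists (x : T) : exists d, x \in tens_fil d.
Proof.
have [N xN] := hcomp_fin x; exists N; apply/tens_filP => w /ltnW /xN.
by move/(congr1 (mcoeff w)); rewrite hcompE eqxx mcoeff0.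
Qed.

Lemma hcomp_mulr d e (x y : T) : y \in homog e -> hcomp (d + e) (x * y) = hcomp d x * y.
Proof.
move=> ye; rewrite hcompM.
have dl : (d < (d + e).+1)%N by rewrite ltnS leq_addr.
rewrite (bigD1 (Ordinal dl)) //= addKn (hcomp_id e ye) eqxx big1 ?addr0 // => i.
rewrite -val_eqE /= => id; rewrite (hcomp_id _ ye); case: eqP => [ide|]; last by rewrite mulr0.
by case/eqP: id; rewrite -(subKn (leq_ord i)) ide addnK.
Qed.

Lemma hcomp_fil d e (x : T) : x \in tens_fil d -> (d < e)%N -> hcomp e x = 0.
Proof.
move=> /tens_filP xd de; apply/malgP => w; rewrite hcompE mcoeff0.
by case: eqP => // we; rewrite xd // we.
Qed.

Lemma hcomp_top d (x : T) : x \in tens_fil d.+1 -> x - hcomp d.+1 x \in tens_fil d.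
Proof.
move=> /tens_filP xd; apply/tens_filP => w wd; rewrite mcoeffB hcompE.
case: eqP => [_|/eqP wd1]; first by rewrite subrr.
by rewrite xd ?subr0 // ltn_neqAle eq_sym wd1.
Qed.

Lemma hcomp_fil0 (x : T) : x \in tens_fil 0 -> hcomp 0 x = x.
Proof. by move/fil0E => ->; rewrite (hcomp_id _ (sc_homog _ _)) eqxx. Qed.

Lemma fil_pred1 d (x : T) : x \in tens_fil d.+1 -> hcomp d.+1 x = 0 -> x \in tens_fil d.
Proof. by move=> /hcomp_top xd x0; rewrite -[x]subr0 -x0. Qed.

Lemma hcomp_sum (x : T) : exists N, x = \sum_(d < N) hcomp d x.
Proof.
have [N xN] := hcomp_fin x; exists N; apply/malgP => w; rewrite raddf_sum /=.
rewrite (eq_bigr (fun d : 'I_N => if size w == d then x@_w else 0)); last first.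
  by move=> d _; rewrite hcompE.
have [wN|/xN/(congr1 (mcoeff w))] := ltnP (size w) N; last first.
  rewrite hcompE eqxx mcoeff0 => ->.
  by rewrite big1 // => d _; rewrite if_same.
rewrite (bigD1 (Ordinal wN)) //= eqxx big1 ?addr0 // => d.
by rewrite -val_eqE eq_sym => /negPf /= ->.
Qed.

End TensorAlgebra.

Lemma linear_comb (K : pzRingType) (U V : lmodType K) (f : {linear U -> V})
    (I : Type) (r : seq I) (c : I -> K) (x : I -> U) :
  f (\sum_(i <- r) c i *: x i) = \sum_(i <- r) c i *: f (x i).
Proof. by rewrite linear_sum; apply: eq_bigr => i _; rewrite linearZ. Qed.

Lemma submod_val_comb (K : pzRingType) (V : lmodType K) (P : submodClosed V)
    (I : Type) (r : seq I) (c : I -> K) (x : I -> submod P) :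
  submod_val (\sum_(i <- r) c i *: x i) = \sum_(i <- r) c i *: submod_val (x i).
Proof. exact: (linear_comb (\val : submod P -> V)). Qed.

Section Deformation.
Variables (K : fieldType) (n : nat) (g : 'M[K]_n).
Hypotheses (g_sym : g^T = g) (g_unit : g \in unitmx).
Local Notation T := (tens K n).
Local Notation G := (invmx g).
Local Notation S := (@gen K n).
Variable phi : {linear submod (cubic_span g) -> submod (@tens_fil K n 2)}.

Let hom : nat -> submodClosed T := fun d => @homog K n d.
Let fil : nat -> submodClosed T := fun d => @tens_fil K n d.
Local Notation cubic := (ideal_gen [set x | x \in cubic_span g]%classic).
Local Notation deformed := (ideal_gen (deformed_rel phi)).

Definition phiW (r : 'I_n) : T := submod_val (phi (cubicW_sub g r)).
(* The value of phi on rel i: its index is lowered by g. *)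
Definition phiL (i : 'I_n) : T := \sum_r g r i *: phiW r.

Local Notation levW := (level S hom (rel S G)).
Local Notation levP := (level S fil (defrel S G phiL)).

Lemma invG_sym : G^T = G.
Proof. by rewrite trmx_inv g_sym. Qed.

Lemma ideal_scale (I : twoSidedIdeal T) k x : x \in I -> k *: x \in I.
Proof. by rewrite -tens_scE; exact: Defs.idealMl. Qed.

Lemma cubicWE r : cubicW g r = \sum_l G l r *: rel S G l.
Proof. exact: cubic_relE. Qed.

Lemma relE i : rel S G i = \sum_r g r i *: cubicW g r.
Proof. by under eq_bigr => r _ do rewrite cubicWE; rewrite mulmx1_comb ?mulVmx. Qed.

Lemma phiWE r : phiW r = \sum_l G l r *: phiL l.
Proof. by rewrite /phiL mulmx1_comb ?mulmxV. Qed.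

Lemma defrelE i : defrel S G phiL i = \sum_r g r i *: (cubicW g r - phiW r).
Proof.
rewrite /defrel relE /phiL -sumrB; apply: eq_bigr => r _.
by rewrite scalerBr.
Qed.

Lemma cubicW_defrel r :
  cubicW g r - phiW r = \sum_l G l r *: defrel S G phiL l.
Proof.
rewrite cubicWE phiWE -sumrB; apply: eq_bigr => l _.
by rewrite -scalerBr.
Qed.

Lemma deformed_relP (x : T) : deformed_rel phi x <->
  exists c : 'I_n -> K, x = \sum_r c r *: (cubicW g r - phiW r).
Proof.
have lin (c : 'I_n -> K) (w := \sum_r c r *: cubicW_sub g r) :
    submod_val w - submod_val (phi w) = \sum_r c r *: (cubicW g r - phiW r).
  rewrite [X in X - _]submod_val_comb (linear_comb phi) [X in _ - X]submod_val_comb.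
  by rewrite -sumrB; apply: eq_bigr => r _; rewrite scalerBr.
split=> [[w _ <-]|[c ->]]; last by rewrite -lin; eexists.
have /asboolP[c wE] := submodP w; exists c.
rewrite -lin; suff -> : w = \sum_r c r *: cubicW_sub g r by [].
by apply: val_inj; rewrite [LHS]wE [RHS]submod_val_comb.
Qed.

Lemma phiW_fil r : phiW r \in tens_fil 2.
Proof. exact: submodP. Qed.

Lemma phiL_fil i : phiL i \in tens_fil 2.
Proof. by apply: rpred_sum => r _; apply: rpredZ; exact: phiW_fil. Qed.

Lemma defrel_deformed i : defrel S G phiL i \in deformed.
Proof.
rewrite defrelE; apply: rpred_sum => r _; apply: ideal_scale.
apply/asboolP => I; apply; apply/deformed_relP.
exists (fun i => (i == r)%:R); rewrite (bigD1 r) //= eqxx scale1r big1 ?addr0 //.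
by move=> l /negPf->; rewrite scale0r.
Qed.

Lemma rel_cubic i : rel S G i \in cubic.
Proof.
rewrite relE; apply: rpred_sum => r _; apply: ideal_scale.
by apply/asboolP => I; apply; exact: cubicW_in_span.
Qed.

Lemma fil_mul d e x y : x \in fil d -> y \in fil e -> x * y \in fil (d + e)%N.
Proof. exact: tens_filM. Qed.

Lemma fil_succ d : {subset fil d <= fil d.+1}.
Proof. exact: tens_fil_le. Qed.

Lemma fil0_scalar x : x \in fil 0 -> exists k : K, x = k%:A.
Proof. by move/fil0E => ->; exists x@_[::]; rewrite -tens_scE mulr1. Qed.

Lemma fil_lastletter d x : x \in fil d.+1 ->
  exists2 y, y \in fil 0 & x = y + \sum_i rder i x * S i.
Proof.
move=> _; exists (sc x@_[::]); last exact: rder_split.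
exact/homog_fil/sc_homog.
Qed.

Lemma deformed_levP x : x \in deformed -> exists k, x \in levP k.
Proof.
apply: (@ideal_gen_ind _ _ (fun x => exists k, x \in levP k))
  => {x} [|x y [k xk] [l yl]|a x [k xk]|a x [k xk]|x].
- by exists 0%N; exact: rpred0.
- exists (maxn k l); apply: submodB.
    exact: (level_le fil_succ (leq_maxl k l) xk).
  exact: (level_le fil_succ (leq_maxr k l) yl).
- have [d ad] := fil_exists a; exists (d + k)%N.
  exact: (level_mull fil_mul ad xk).
- have [d ad] := fil_exists a; exists (k + d)%N.
  exact: (levP_mulr fil_succ (@rder_fil K n) fil0_scalar fil_lastletter xk ad).
move=> /deformed_relP[c ->]; exists 1%N; apply: rpred_sum => r _; apply: rpredZ.
rewrite cubicW_defrel; apply: rpred_sum => l _; apply: rpredZ.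
rewrite -[defrel _ _ _ _]mul1r; apply: level_mulp.
by have := homog_fil (sc_homog n (1 : K)); rewrite rmorph1.
Qed.

Lemma PBW_kernel : PBW phi <-> forall x, x \in hseq_ker phi -> x \in cubic.
Proof.
have [hB _ _] := hseq_alg_hom deformed.
have eq_map (x y : T) : canonical_map phi (qproj _ x) = canonical_map phi (qproj _ y)
    <-> x - y \in hseq_ker phi.
  by rewrite !canonical_mapE hseq_kerE hB; split=> [/qprojP|xy]; last exact/qprojP.
split=> [[f fK _] x xk|ker].
  have /(congr1 f) : canonical_map phi (qproj _ x) = canonical_map phi (qproj _ 0).
    by apply/eq_map; rewrite subr0.
  by rewrite !fK => /qprojP; rewrite subr0.
have inj : injective (canonical_map phi).
  move=> a b; case: (qproj_surj a) (qproj_surj b) => x <- [y <-].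
  by move/eq_map/ker => xy; exact/qprojP.
have [f fE] := choice (@canonical_map_surj _ _ _ phi).
by exists f => // a; apply: inj; rewrite fE.
Qed.

Lemma phi_overlapE : \sum_i (phiL i * up S G i + up S G i * phiL i) =
  \sum_r (phiW r * S r + S r * phiW r).
Proof.
apply: overlap_lower => r; rewrite -[RHS](mulmx1_comb S r (mulVmx g_unit)).
apply: eq_bigr => i _; congr (_ *: _).
by rewrite -[in LHS]g_sym mxE.
Qed.

Lemma defrel_comb (c : 'I_n -> K) :
  \sum_r c r *: (cubicW g r - phiW r) =
  \sum_l (\sum_r c r * G l r) *: defrel S G phiL l.
Proof.
under [LHS]eq_bigr => r _ do rewrite cubicW_defrel scaler_sumr.
rewrite exchange_big; apply: eq_bigr => l _ /=; rewrite scaler_suml.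
by apply: eq_bigr => r _; rewrite scalerA.
Qed.

Lemma defrel_small i : (n <= 1)%N -> defrel S G phiL i = 0.
Proof.
move=> n1; have S0 j : rel S G j = 0 by exact: rel_eq0.
have W0 r : cubicW g r = 0.
  by rewrite cubicWE big1 // => l _; rewrite S0 scaler0.
rewrite defrelE big1 // => r _; rewrite W0 /phiW.
suff -> : cubicW_sub g r = 0.
  by rewrite raddf0 subr0 scaler0.
exact/val_inj/W0.
Qed.

Lemma levP_reducible : (exists c : 'I_n -> K,
    \sum_r (phiW r * S r + S r * phiW r) = \sum_r c r *: (cubicW g r - phiW r)) ->
  forall k x, x \in levP k.+1 -> x \in fil k.+2 -> x \in levP k.
Proof.
move=> [c cE] k x; have [n1|n_gt1] := leqP n 1.
  move=> /(level_eq0 (fun r => defrel_small r n1))-> _; exact: rpred0.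
apply: (levP_reduce (@homogM K n) (@gen_homog K n) (@rder_mulgen K n) invG_sym _
  n_gt1 fil_mul fil_succ (@homog_fil K n) (@rder_fil K n) fil0_scalar
  fil_lastletter (@hcomp_homog K n) (@hcomp_mulr K n) _ (@hcomp_top K n)
  (@hcomp_fil0 K n) phiL_fil).
- by rewrite unitmx_inv.
- by move=> d y yd; exact: hcomp_fil yd _.
by exists (fun l => \sum_r c r * G l r); rewrite phi_overlapE cE defrel_comb.
Qed.

Lemma overlap_PBW : (exists c : 'I_n -> K,
    \sum_r (phiW r * S r + S r * phiW r) = \sum_r c r *: (cubicW g r - phiW r)) ->
  PBW phi.
Proof.
move=> /levP_reducible red; apply/PBW_kernel => x.
rewrite hseq_kerE => /asboolP xk; have [N ->] := hcomp_sum x.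
apply: rpred_sum => d _.
suff /(level_ideal rel_cubic) : hcomp d x \in levW d.-2 by [].
have [y yd /deformed_levP[k xyk]] : exists2 y : T,
    ((if d : nat is e.+1 then y \in fil e else y == 0) : bool) & hcomp d x - y \in deformed.
  have := xk d; case: (nat_of_ord d) => [|e] /=.
    by move=> /eqP xe; exists 0 => //; apply/qprojP; rewrite [RHS]raddf0.
  by move=> /asboolP[y ye xy]; exists y => //; apply/qprojP.
have top0 e (z : T) : z \in fil e -> hcomp e.+1 z = 0.
  by move=> ze; exact: hcomp_fil ze _.
have top_id e (z : T) : z \in hom e -> hcomp e z = z.
  by move=> ze; rewrite (hcomp_id e ze) eqxx.
exact (levP_leading (hom := hom) (@homogM K n) (@gen_homog K n) fil_mul fil_succ
  (@homog_fil K n) (@hcomp_homog K n) (@hcomp_mulr K n) top0 phiL_fil top_id red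
  (hcomp_homog d x) yd xyk).
Qed.

Lemma cubic_low x : x \in cubic ->
  (forall d, (d < 3)%N -> hcomp d x = 0) /\ hcomp 3 x \in cubic_span g.
Proof.
apply: (@ideal_gen_ind _ _ (fun x => (forall d, (d < 3)%N -> hcomp d x = 0) /\
    hcomp 3 x \in cubic_span g)) => {x}
  [|x y [xl x3] [yl y3]|a x [xl x3]|a x [xl x3]|x xg].
- by split=> [d _|]; rewrite raddf0 // rpred0.
- split=> [d d3|]; rewrite raddfB /=; first by rewrite xl ?yl ?subr0.
  exact: submodB.
- split=> [d d3|]; rewrite hcompM.
    by rewrite big1 // => i _; rewrite xl ?mulr0 // (leq_ltn_trans (leq_subr _ _)).
  rewrite big_ord_recl big1 => [|i _]; last first.
    by rewrite xl ?mulr0 //= /bump add1n subSS ltnS leq_subr.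
  have /homog_fil/fil0E -> := hcomp_homog 0 a.
  by rewrite addr0 tens_scE subn0; exact: rpredZ.
- split=> [d d3|]; rewrite hcompM.
    by rewrite big1 // => i _; rewrite xl ?mul0r // (leq_ltn_trans (leq_ord i)).
  rewrite big_ord_recr /= big1 => [|i _]; last by rewrite xl ?mul0r //= ltn_ord.
  have /homog_fil/fil0E -> := hcomp_homog (3 - 3) a.
  by rewrite add0r -sc_comm tens_scE; exact: rpredZ.
have x3 := cubic_span_homog xg; split=> [d d3|]; rewrite (hcomp_id _ x3) //.
by rewrite (ltn_eqF d3).
Qed.

Section Necessity.
Hypothesis phiPBW : PBW phi.

Lemma PBW_leading d x : x \in deformed -> x \in tens_fil d -> hcomp d x \in cubic.
Proof.
move=> xJ xd; have /PBW_kernel := phiPBW; apply; rewrite hseq_kerE.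
apply/asboolP => e /=; rewrite (hcomp_id e (hcomp_homog d x)).
case: eqP => [->|_]; last by rewrite raddf0 rpred0.
have x0 : qproj deformed x = 0.
  by rewrite -(raddf0 (qproj deformed)); apply/qprojP; rewrite subr0.
case: d xd => [|d] xd /=; first by rewrite hcomp_fil0 // x0 inE.
have -> : qproj deformed (hcomp d.+1 x) = qproj deformed (hcomp d.+1 x - x).
  by rewrite raddfB /= x0 subr0.
by apply: img_fil_qproj; rewrite -opprB; apply: submodN; exact: hcomp_top.
Qed.

Lemma PBW_deformed_fil2 x : x \in deformed -> x \in tens_fil 2 -> x = 0.
Proof.
move=> xJ.
have low d : (d < 3)%N -> x \in tens_fil d -> hcomp d x = 0.
  move=> d3 xd; have /cubic_low[/(_ d d3)] := PBW_leading xJ xd.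
  by rewrite (hcomp_id d (hcomp_homog d x)) eqxx.
move=> x2; have x1 := fil_pred1 x2 (low 2%N isT x2).
have x0 := fil_pred1 x1 (low 1%N isT x1).
by rewrite -(hcomp_fil0 x0) low.
Qed.

Lemma PBW_overlap : exists c : 'I_n -> K,
  \sum_r (phiW r * S r + S r * phiW r) = \sum_r c r *: (cubicW g r - phiW r).
Proof.
set z := \sum_r (phiW r * S r + S r * phiW r).
have zJ : z \in deformed.
  have -> : z = - \sum_i (defrel S G phiL i * up S G i + up S G i * defrel S G phiL i).
    by rewrite /z -phi_overlapE; exact: phi_overlap invG_sym phiL.
  rewrite rpredN; apply: rpred_sum => i _.
  by apply: rpredD; [apply: Defs.idealMr | apply: Defs.idealMl]; exact: defrel_deformed.
have z3 : z \in tens_fil 3.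
  apply: rpred_sum => r _; apply: rpredD.
    exact: (tens_filM (phiW_fil r) (homog_fil (gen_homog K r))).
  exact: (tens_filM (homog_fil (gen_homog K r)) (phiW_fil r)).
have /cubic_low[_] := PBW_leading zJ z3.
rewrite (hcomp_id _ (hcomp_homog 3 z)) eqxx => /asboolP[c cE]; exists c.
apply/eqP; rewrite -subr_eq0; apply/eqP/PBW_deformed_fil2.
  rewrite rpredB //; apply/asboolP => I; apply; apply/deformed_relP; by exists c.
have -> : z - \sum_r c r *: (cubicW g r - phiW r) =
    (z - hcomp 3 z) + \sum_r c r *: phiW r.
  rewrite cE -addrA; congr (_ + _); rewrite addrC -sumrB -sumrN.
  by apply: eq_bigr => r _; rewrite scalerBr opprB.
apply: rpredD; first exact: hcomp_top.
by apply: rpred_sum => r _; apply: rpredZ; exact: phiW_fil.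
Qed.

End Necessity.

End Deformation.

Section Coefficients.
Variables (K : fieldType) (n : nat) (G : 'M[K]_n).
Hypotheses (charK : 2%N \notin [pchar K]) (G_sym : G^T = G).
Variables (j2 : 'I_n -> 'I_n -> 'I_n -> K) (j1 : 'I_n -> 'I_n -> K) (j0 : 'I_n -> K).

Lemma two_neq0 : 2%:R != 0 :> K.
Proof. by apply: contra charK => two0; rewrite inE. Qed.

Lemma mulr2n_inj : injective (fun x : K => x *+ 2).
Proof.
move=> x y /eqP; rewrite -subr_eq0 -mulrnBl -mulr_natr mulf_eq0 (negPf two_neq0).
by rewrite orbF subr_eq0 => /eqP.
Qed.

Lemma half_mulr2n (y : K) : (- 2^-1 * y) *+ 2 = - y.
Proof.
by rewrite mulNr mulNrn -mulrnAl -[2^-1 *+ 2]mulr_natr mulVf ?two_neq0 // mul1r.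
Qed.

Variable b : 'I_n -> K.
Let B i := \sum_r G i r * b r.

Lemma cubic_coefE a c d :
  \sum_r b r * (G a c * G d r - G a r * G c d) = G a c * B d - B a * G c d.
Proof.
rewrite mulr_sumr mulr_suml -sumrB; apply: eq_bigr => r _.
by ring.
Qed.

Lemma deform_coefE a c d :
  \sum_r (G a d * G c r - G c d * G a r) * b r = G a d * B c - G c d * B a.
Proof.
rewrite !mulr_sumr -sumrB; apply: eq_bigr => r _.
by ring.
Qed.

(* Inverting 1 + P, with P the cyclic rotation of the indices: the inverse is
   (1 - P + P^2) / 2. *)
Lemma j2_system :
  (forall a c d, j2 a c d + j2 c d a = G a c * B d - B a * G c d) <->
  (forall a c d, j2 a c d = G a d * B c - G c d * B a).
Proof.
have GC i j : G i j = G j i by rewrite -[in LHS]G_sym mxE.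
split=> E a c d; last by rewrite !E (GC c a) (GC d a) (GC c d); ring.
apply: mulr2n_inj => /=.
have -> : j2 a c d *+ 2 =
    (j2 a c d + j2 c d a) - (j2 c d a + j2 d a c) + (j2 d a c + j2 a c d) by ring.
by rewrite !E (GC d a); ring.
Qed.

Lemma coef_system :
  [/\ forall a c d, j2 a c d + j2 c d a =
         \sum_r b r * (G a c * G d r - G a r * G c d),
      forall a c, j1 a c + j1 c a = - \sum_r b r * j2 a c r,
      forall a, j0 a *+ 2 = - \sum_r b r * j1 a r
    & 0 = - \sum_r b r * j0 r] <->
  [/\ forall a c d, j2 a c d = \sum_r (G a d * G c r - G c d * G a r) * b r,
      forall a c, j1 a c = - j1 c a
    & forall a, j0 a = - 2^-1 * \sum_r j1 a r * b r].
Proof.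
have j2b (E : forall a c d, j2 a c d = G a d * B c - G c d * B a) a c :
    \sum_r b r * j2 a c r = 0.
  transitivity (\sum_r ((G a r * b r) * B c - (G c r * b r) * B a)).
    by apply: eq_bigr => r _; rewrite E; ring.
  by rewrite sumrB -!mulr_suml -/(B a) -/(B c) mulrC subrr.
have j1C a : \sum_r b r * j1 a r = \sum_r j1 a r * b r.
  by apply: eq_bigr => r _; rewrite mulrC.
split=> [[E3 E2 E1 E0]|[E3 E2 E1]].
  have {}E3 : forall a c d, j2 a c d = G a d * B c - G c d * B a.
    by apply/j2_system => a c d; rewrite E3 cubic_coefE.
  split=> [a c d|a c|a]; first by rewrite E3 deform_coefE.
    by apply/eqP; rewrite -addr_eq0 E2 j2b // oppr0.
  by apply: mulr2n_inj; rewrite /= E1 j1C half_mulr2n.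
have {}E3 a c d : j2 a c d = G a d * B c - G c d * B a by rewrite E3 deform_coefE.
split=> [a c d|a c|a|].
- rewrite cubic_coefE; exact: (j2_system.2 E3).
- by rewrite j2b // oppr0 E2 addNr.
- by rewrite E1 j1C half_mulr2n.
pose z := \sum_a \sum_r b a * j1 a r * b r.
have z0 : z = 0.
  apply: mulr2n_inj; rewrite /= mul0rn mulr2n; apply/eqP.
  rewrite addr_eq0 {1}/z exchange_big -sumrN; apply/eqP/eq_bigr => a _ /=.
  by rewrite -sumrN; apply: eq_bigr => r _; rewrite E2; ring.
apply/esym/eqP; rewrite oppr_eq0; apply/eqP.
transitivity (- 2^-1 * z); last by rewrite z0 mulr0.
rewrite mulr_sumr; apply: eq_bigr => a _; rewrite E1 mulrCA mulr_sumr.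
by congr (_ * _); apply: eq_bigr => r _; rewrite mulrA.
Qed.

End Coefficients.

Theorem theorem8 (K : fieldType) (s : nat) (g : 'M[K]_s.+1)
  (charK : 2%N \notin [pchar K])
  (g_sym : g^T = g) (g_nondeg : g \in unitmx)
  (phi : {linear submod (cubic_span g) -> submod (@tens_fil K s.+1 2)})
  (j2 : 'I_s.+1 -> 'I_s.+1 -> 'I_s.+1 -> K)
  (j1 : 'I_s.+1 -> 'I_s.+1 -> K)
  (j0 : 'I_s.+1 -> K)
  (phiE : forall rho : 'I_s.+1,
     submod_val (phi (cubicW_sub g rho)) =
       \sum_alpha \sum_beta j2 alpha beta rho *: (gen K alpha * gen K beta)
       + \sum_alpha j1 alpha rho *: gen K alpha
       + j0 rho *: 1) :
  PBW phi <->
  exists (b : 'I_s.+1 -> K) (omega : 'I_s.+1 -> 'I_s.+1 -> K),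
    (forall alpha beta, omega alpha beta = - omega beta alpha) /\
    (forall alpha beta gamma,
      [/\ j2 alpha beta gamma =
            \sum_rho (invmx g alpha gamma * invmx g beta rho
                      - invmx g beta gamma * invmx g alpha rho) * b rho,
          j1 alpha beta = omega alpha beta
        & j0 alpha = - 2^-1 * \sum_rho omega alpha rho * b rho]).
Proof.
have overlapE (c : 'I_s.+1 -> K) :
    \sum_r (phiW phi r * gen K r + gen K r * phiW phi r) =
      \sum_r c r *: (cubicW g r - phiW phi r) <->
    low (@gen K s.+1) (fun a b c => j2 a b c + j2 b c a) (fun a b => j1 a b + j1 b a)
      (fun a => j0 a *+ 2) 0 =
    low (@gen K s.+1)
      (fun a b d => \sum_r c r * (invmx g a b * invmx g d r - invmx g a r * invmx g b d))
      (fun a b => - \sum_r c r * j2 a b r) (fun a => - \sum_r c r * j1 a r)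
      (- \sum_r c r * j0 r).
  rewrite -low_overlap -low_sum_relB.
  under eq_bigr => r _ do rewrite /phiW phiE.
  under [in X in _ = X]eq_bigr => r _ do rewrite /phiW phiE cubicWE.
  by [].
have G_sym := invG_sym g_sym.
split=> [/(PBW_overlap g_sym g_nondeg)[b /overlapE/low_eq E]|[b [om [om_anti E]]]].
  have /(coef_system charK G_sym)[E3 E2 E1] := E _ (@rder_mulgen K s.+1) (@rder1 K s.+1).
  by exists b, j1; split.
apply: (overlap_PBW g_sym g_nondeg); exists b; apply/overlapE.
have j1E a c : j1 a c = om a c by have [] := E a c a.
have /(coef_system charK G_sym)[E3 E2 E1 E0] : [/\ forall a c d, j2 a c d =
    \sum_r (invmx g a d * invmx g c r - invmx g c d * invmx g a r) * b r,
    forall a c, j1 a c = - j1 c a &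
    forall a, j0 a = - 2^-1 * \sum_r j1 a r * b r].
  split=> [a c d|a c|a]; first by have [] := E a c d.
    by rewrite !j1E om_anti.
  have [_ _ ->] := E a a a; congr (_ * _).
  by apply: eq_bigr => r _; rewrite j1E.
exact: low_ext.
Qed.
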